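(* Let $r \geq 4$ be an integer. If $T$ is a tree on at least $r+1$ vertices, then the $r$-Stirling colour graph $\mathcal{S}_r(T)$ is Hamiltonian.
   Context: Graphs are finite and simple. For a graph $G$ and a positive integer $k$, the $k$-Stirling colour graph of $G$, denoted $\mathcal{S}_k(G)$, is the graph whose vertices are the partitions of $V(G)$ into exactly $k$ non-empty independent sets, with different partitions $p_1$ and $p_2$ being adjacent if there is a vertex $x \in V(G)$ such that the restrictions of $p_1$ and $p_2$ to $V(G)-\{x\}$ are equal (after restriction, empty cells are discarded). A graph is Hamiltonian if it has a cycle containing all of its vertices; in particular a Hamiltonian graph has at least three vertices, so $K_1$ and $K_2$ are not Hamiltonian. *)

(* Defs.v *)
From mathcomp Require Import all_boot.

Set Implicit Arguments.
Unset Strict Implicit.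
Unset Printing Implicit Defensive.

Record sgraph := SGraph {
  vertex :> finType;
  adj : rel vertex;
  adj_sym : symmetric adj;
  adj_irr : irreflexive adj }.

Definition independent (G : sgraph) (A : {set G}) : bool :=
  [forall x in A, forall y in A, ~~ adj x y].

(* [ucycle] alone also accepts the empty sequence and, as [adj] is symmetric,
   a single edge traversed back and forth, hence the condition on the size. *)
Definition graph_cycle (G : sgraph) (c : seq G) : Prop :=
  2 < size c /\ ucycle (@adj G) c.

Definition hamiltonian (G : sgraph) : Prop :=
  exists c : seq G, graph_cycle c /\ forall x : G, x \in c.

Definition connected (G : sgraph) : Prop :=
  0 < #|G| /\ forall x y : G, connect (@adj G) x y.

Definition acyclic (G : sgraph) : Prop :=
  forall c : seq G, ~ graph_cycle c.

Definition tree (G : sgraph) : Prop := connected G /\ acyclic G.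

Section Stirling.

Variables (k : nat) (G : sgraph).

(* Cells are non-empty: [partition] includes [set0 \notin p]. *)
Definition stirling_partition (p : {set {set G}}) : bool :=
  [&& partition p [set: G], #|p| == k & [forall A in p, independent A]].

(* The partition of V(G) - {x} induced by p, empty cells discarded. *)
Definition restrict_partition (x : G) (p : {set {set G}}) : {set {set G}} :=
  [set A :\ x | A in p] :\ set0.

Definition stirling_vertex := {p : {set {set G}} | stirling_partition p}.

Definition stirling_adj : rel stirling_vertex :=
  [rel p q | (p != q) &&
    [exists x : G, restrict_partition x (val p) == restrict_partition x (val q)]].

Lemma stirling_adj_sym : symmetric stirling_adj.
Proof.
move=> p q; rewrite /stirling_adj /= eq_sym; congr (_ && _).
by apply: eq_existsb => x; rewrite eq_sym.
Qed.

Lemma stirling_adj_irr : irreflexive stirling_adj.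
Proof. by move=> p; rewrite /stirling_adj /= eqxx. Qed.

Definition stirling_graph : sgraph := SGraph stirling_adj_sym stirling_adj_irr.

End Stirling.

(* Main.v *)
Require Import Defs.
From mathcomp Require Import all_boot.

Set Implicit Arguments.
Unset Strict Implicit.
Unset Printing Implicit Defensive.

(** Let [x] be a leaf of a tree [T] with neighbour [y], and [T'] the tree [T - x].
    A vertex of [S_r(T)] either has [x] as a singleton cell, and is then a vertex
    of [S_(r-1)(T')], or arises from a vertex [p] of [S_r(T')] by adding [x] to one
    of the [r - 1] cells of [p] that avoid [y].  The placements of [x] above one
    [p] form a clique of [r - 1] vertices, so that [S_r(T)] consists of a copy of
    [S_(r-1)(T')] and of [S_r(T')] blown up by cliques.

    For [r >= 4] a Hamiltonian cycle of [S_r(T)] is obtained by induction.  The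
    cliques have at least three vertices.  A move of a vertex other than [y] is
    available above [p] for every placement of [x], a move of [y] for all of them
    but at most one, and this suffices to lift a Hamiltonian cycle of [S_r(T')] to
    a Hamiltonian path of the blow-up between two prescribed vertices of one
    clique ([blowup_cycle], [fibres_traversal]).  It remains to splice in a
    Hamiltonian path of the copy of [S_(r-1)(T')].  This is possible when the path
    is hooked ([hooked]): for some partition [p] of [T'] into [r] cells with
    singleton cells [{u}] and [{w}], both different from [{y}], its first vertex
    results from [p] by relocating [u], and its last vertex by relocating [w].
    Then the ends of the path are adjacent to the two vertices in which [x] joins
    [{u}], respectively [{w}], in the clique of [p].  The new cycle, cut open at
    one of the two new edges, is again a hooked path, because [x] and [u] (or [x]
    and [w]) are singletons once [x] is split off from [p] ([leaf_step]); this
    hook avoids any vertex prescribed beforehand, if [x] is chosen different from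
    it.  So the hypothesis on [r - 1] is only ever a hooked Hamiltonian path, and
    the induction can start at [r = 3], where cycles need not exist.

    For [r = 3], fix an edge [ab] of the tree and the colours of [a] and [b].
    The proper three-colourings then correspond to the partitions into two or
    three independent cells, and the only partition into two cells comes from the
    two-colouring [c0].  A Hamiltonian cycle of these colourings under recolouring
    of one vertex becomes a Hamiltonian path of [S_3(T)] when [c0] is deleted.  If
    the vertices [z] and [u] are recoloured next to [c0] on the cycle, the ends of
    the path are hooked by the partition in which both [z] and [u] are split off
    from the cells of [c0] ([gray_hooked]).

    Such cycles are built by adding leaves.  Leaves added at [a], which is never
    recoloured, double the cycle as in a prism, and this covers stars ([prism]).
    A tree that is not a star has two leaves [x] and [x'] with different
    neighbours.  Each colouring of the rest extends to a square of four, a move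
    never blocks both of the exits available in a square, and so a walk around the
    cycle can always proceed ([lifts_traversal]).  It closes up for a reason of
    parity: every vertex has a height, given by the signed colour changes along
    the path from [a], hence a parity that switches exactly when that vertex is
    recoloured ([graded_leaf]), so the graph of colourings is bipartite, and a
    path through complete squares has an even number of vertices
    ([square_step]). *)

Local Notation rst := restrict_partition.

(** * Partitions into independent cells *)

Lemma setD1_notin (T : finType) (x : T) (A : {set T}) : x \notin A -> A :\ x = A.
Proof. by move=> xA; apply/setP => v; rewrite !inE; case: eqP => // ->; apply/esym/negbTE. Qed.

Section Partitions.

Variable G : sgraph.
Implicit Types (S A B C : {set G}) (P Q p q : {set {set G}}) (x y z u v w : G).

(** The vertices of the Stirling colour graph of the subgraph induced on [S], kept
    as partitions in the ambient type so that [S] can vary in an induction. *)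
Definition stirling (k : nat) S : {set {set {set G}}} :=
  [set P | [&& partition P S, #|P| == k & [forall A in P, independent A]]].

Definition padj : rel {set {set G}} :=
  [rel p q | (p != q) && [exists x, rst x p == rst x q]].

Definition add_single x P : {set {set G}} := [set x] |: P.

Definition add_to x C P : {set {set G}} := (x |: C) |: (P :\ C).

Lemma padj_sym : symmetric padj.
Proof.
move=> p q; rewrite /padj /= eq_sym; congr (_ && _).
by apply: eq_existsb => x; rewrite eq_sym.
Qed.

Lemma padjI x p q : p != q -> rst x p = rst x q -> padj p q.
Proof. by move=> pq e; rewrite /padj /= pq; apply/existsP; exists x; rewrite e. Qed.

Lemma indepP A : reflect {in A &, forall x y, ~~ adj x y} (independent A).
Proof.
apply: (iffP forall_inP) => [h x y xA yA|h x xA].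
  by have /forall_inP := h x xA; apply.
by apply/forall_inP => y yA; apply: h.
Qed.

Lemma indepS A B : A \subset B -> independent B -> independent A.
Proof.
move=> /subsetP sAB /indepP iB; apply/indepP => x y xA yA.
by apply: iB; apply: sAB.
Qed.

Lemma stirlingP k S P :
  reflect [/\ partition P S, #|P| = k & {in P, forall A, independent A}]
          (P \in stirling k S).
Proof.
rewrite inE; apply: (iffP and3P) => [[h1 /eqP h2 /forall_inP h3]|[h1 h2 h3]].
  by [].
by split=> //; [apply/eqP|apply/forall_inP].
Qed.

Lemma partitionI P S :
  {in P, forall A, A != set0 /\ A \subset S} ->
  (forall v, v \in S -> exists2 A, A \in P & v \in A) ->
  (forall A B v, A \in P -> B \in P -> v \in A -> v \in B -> A = B) ->
  partition P S.
Proof.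
move=> h1 h2 h3; apply/and3P; split.
- apply/eqP/setP => v; apply/bigcupP/idP => [[A AP vA]|/h2[A AP vA]].
    by have [_ /subsetP] := h1 A AP; apply.
  by exists A.
- apply/trivIsetP => A B AP BP; apply: contraNT => /pred0Pn[v /andP[/= vA vB]].
  by apply/eqP; apply: h3 vA vB.
- by apply/negP => /h1[]; rewrite eqxx.
Qed.

Lemma cell_eq P S A B v :
  partition P S -> A \in P -> B \in P -> v \in A -> v \in B -> A = B.
Proof.
move=> /and3P[_ tP _] AP BP vA vB.
by rewrite -(def_pblock tP AP vA) (def_pblock tP BP vB).
Qed.

Lemma cell_sub P S A : partition P S -> A \in P -> A \subset S.
Proof. by move=> /and3P[/eqP<- _ _] AP; apply: bigcup_sup. Qed.

Lemma cell_neq0 P S A : partition P S -> A \in P -> A != set0.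
Proof. by move=> /and3P[_ _ P0] AP; apply: contraNneq P0 => <-. Qed.

Lemma cell_pblock P S v :
  partition P S -> v \in S -> pblock P v \in P /\ v \in pblock P v.
Proof.
move=> /and3P[/eqP cP _ _]; rewrite -{1}cP => vc.
by rewrite pblock_mem // mem_pblock.
Qed.

Lemma rstP x P A :
  reflect (exists2 B, B \in P & A = B :\ x /\ A != set0) (A \in rst x P).
Proof.
rewrite inE !inE; apply: (iffP andP) => [[A0 /imsetP[B BP e]]|[B BP [e A0]]].
  by exists B.
by split=> //; apply/imsetP; exists B.
Qed.

Lemma rst_cell x P A : A \in P -> A :\ x != set0 -> A :\ x \in rst x P.
Proof. by move=> AP A0; apply/rstP; exists A. Qed.

Lemma rst_partition x P S : partition P S -> partition (rst x P) (S :\ x).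
Proof.
move=> pP; apply: partitionI => [_ /rstP[B BP [-> ?]]|v|A1 B1 v].
- by split=> //; apply: setSD; apply: cell_sub pP BP.
- rewrite !inE => /andP[vx /(cell_pblock pP)[BP vB]].
  have vBx : v \in pblock P v :\ x by rewrite !inE vx.
  exists (pblock P v :\ x) => //; apply: rst_cell => //.
  by apply/set0Pn; exists v.
- move=> /rstP[A AP [-> _]] /rstP[B BP [-> _]]; rewrite !inE.
  by move=> /andP[_ vA] /andP[_ vB]; rewrite (cell_eq pP AP BP vA vB).
Qed.

Lemma rst_id x P S : partition P S -> x \notin S -> rst x P = P.
Proof.
move=> pP xS; have e A : A \in P -> A :\ x = A.
  move=> AP; apply: setD1_notin; apply: contraNN xS.
  by apply/subsetP; apply: cell_sub pP AP.
apply/setP => A; apply/rstP/idP => [[B BP [-> _]]|AP]; first by rewrite e.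
by exists A => //; rewrite e //; split=> //; apply: cell_neq0 pP AP.
Qed.

Lemma cellD1_neq0 x P S A :
  partition P S -> [set x] \notin P -> A \in P -> A :\ x != set0.
Proof.
move=> pP xP AP; rewrite setD_eq0 subset1 (negbTE (cell_neq0 pP AP)) orbF.
by apply: contraNneq xP => <-.
Qed.

Lemma cellD1_inj x P S A B : partition P S -> A \in P -> B \in P ->
  A :\ x != set0 -> A :\ x = B :\ x -> A = B.
Proof.
move=> pP AP BP /set0Pn[v vA] e.
have: v \in B :\ x by rewrite -e.
by move: vA; rewrite !inE => /andP[_ vA] /andP[_ vB]; apply: cell_eq pP AP BP vA vB.
Qed.

Lemma rst_card x P S : partition P S -> [set x] \notin P -> #|rst x P| = #|P|.
Proof.
move=> pP xP.
have -> : rst x P = [set A :\ x | A in P].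
  apply/setP => A; rewrite inE !inE andb_idl // => /imsetP[B BP ->].
  exact: cellD1_neq0 pP xP BP.
apply: card_in_imset => A B AP BP; apply: (cellD1_inj pP) => //.
exact: cellD1_neq0 pP xP AP.
Qed.

Lemma rst_stirling x k S P :
  P \in stirling k S -> [set x] \notin P -> rst x P \in stirling k (S :\ x).
Proof.
move=> /stirlingP[pP cP iP] xP; apply/stirlingP; split.
- exact: rst_partition.
- by rewrite (rst_card pP).
- by move=> _ /rstP[B BP [-> _]]; apply: indepS (subD1set _ _) (iP B BP).
Qed.

Lemma add_single_stirling x k S P : x \notin S ->
  P \in stirling k S -> add_single x P \in stirling k.+1 (x |: S).
Proof.
move=> xS /stirlingP[pP cP iP].
have xP A : A \in P -> x \notin A.
  by move=> AP; apply: contraNN xS; apply/subsetP; apply: cell_sub pP AP.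
apply/stirlingP; split.
- apply: partitionI => [A|v|A B v].
  + rewrite !inE => /orP[/eqP->|AP].
      by rewrite -card_gt0 cards1; split=> //; apply: subsetUl.
    by split; [apply: cell_neq0 pP AP|apply: subsetU; rewrite (cell_sub pP AP) orbT].
  + rewrite !inE => /orP[/eqP->|/(cell_pblock pP)[BP vB]].
      by exists [set x]; rewrite !inE ?eqxx.
    by exists (pblock P v) => //; rewrite inE BP orbT.
  + rewrite !inE => /orP[/eqP->|AP] /orP[/eqP->|BP] //; rewrite ?inE.
    * by move=> /eqP-> /(negP (xP B BP)).
    * by move=> vA /eqP vx; move: (xP A AP); rewrite -vx vA.
    * exact: cell_eq pP AP BP.
- rewrite cardsU1 cP; case: (boolP (_ \in P)) => [/xP|//].
  by rewrite !inE eqxx.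
- move=> A; rewrite !inE => /orP[/eqP->|/iP//].
  by apply/indepP => u v; rewrite !inE => /eqP-> /eqP->; rewrite adj_irr.
Qed.

Lemma add_to_stirling x k S C P : x \notin S -> P \in stirling k S -> C \in P ->
  {in C, forall v, ~~ adj x v} -> add_to x C P \in stirling k (x |: S).
Proof.
move=> xS /stirlingP[pP cP iP] CP nC.
have xP A : A \in P -> x \notin A.
  by move=> AP; apply: contraNN xS; apply/subsetP; apply: cell_sub pP AP.
apply/stirlingP; split.
- apply: partitionI => [A|v|A B v].
  + rewrite !inE => /orP[/eqP->|/andP[_ AP]].
      split; last by apply: setUS; apply: cell_sub pP CP.
      by apply/set0Pn; exists x; rewrite !inE eqxx.
    by split; [apply: cell_neq0 pP AP|apply: subsetU; rewrite (cell_sub pP AP) orbT].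
  + rewrite !inE => /orP[/eqP->|/(cell_pblock pP)[BP vB]].
      by exists (x |: C); rewrite !inE ?eqxx.
    case: (eqVneq (pblock P v) C) => [e|ne].
      by exists (x |: C); rewrite !inE ?eqxx // -e vB orbT.
    by exists (pblock P v) => //; rewrite !inE BP ne orbT.
  + rewrite !inE => /orP[/eqP->|/andP[nA AP]] /orP[/eqP->|/andP[nB BP]] //; rewrite ?inE.
    * move=> /orP[/eqP-> /(negP (xP B BP))//|vC vB].
      by move: nB; rewrite (cell_eq pP CP BP vC vB) eqxx.
    * move=> vA /orP[/eqP vx|vC]; first by move: (xP A AP); rewrite -vx vA.
      by move: nA; rewrite (cell_eq pP CP AP vC vA) eqxx.
    * exact: cell_eq pP AP BP.
- rewrite cardsU1 -cP (cardsD1 C P) CP; congr (nat_of_bool _ + _).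
  apply/negP; rewrite !inE => /andP[_ /xP].
  by rewrite !inE eqxx.
- move=> A; rewrite !inE => /orP[/eqP->|/andP[_ /iP//]].
  have /indepP iC := iP C CP.
  apply/indepP => u v; rewrite !inE => /orP[/eqP->|uC] /orP[/eqP->|vC].
  + by rewrite adj_irr.
  + exact: nC.
  + by rewrite adj_sym; apply: nC.
  + exact: iC.
Qed.

Lemma rst_add_single_id x P S : partition P S -> x \notin S -> rst x (add_single x P) = P.
Proof.
move=> pP xS; rewrite -[RHS](rst_id pP xS); apply/setP => A.
apply/rstP/rstP => -[B]; rewrite ?inE.
  by move=> /orP[/eqP->|BP] [-> h]; [rewrite setDv eqxx in h|exists B].
by move=> BP e; exists B; rewrite ?inE ?BP ?orbT.
Qed.

Lemma rst_add_single x z P : z != x -> rst z (add_single x P) = add_single x (rst z P).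
Proof.
move=> zx; have e : [set x] :\ z = [set x] by rewrite setD1_notin // inE.
apply/setP => A; rewrite /add_single in_setU1; apply/rstP/idP => [[B]|].
  rewrite in_setU1 => /orP[/eqP->|BP] [-> h]; first by rewrite e eqxx.
  by apply/orP; right; apply: rst_cell.
case/orP => [/eqP->|/rstP[B BP eB]]; last by exists B => //; rewrite in_setU1 BP orbT.
exists [set x]; rewrite ?in_setU1 ?eqxx //.
by rewrite e -card_gt0 cards1.
Qed.

(** If [C] is the cell of [z] alone, [C :\ z] is empty and the right-hand side has
    [x] as a singleton, as it should. *)
Lemma rst_add_to x z C P S : partition P S -> z != x -> x \notin S -> C \in P ->
  rst z (add_to x C P) = add_to x (C :\ z) (rst z P).
Proof.
move=> pP zx xS CP.
have e : (x |: C) :\ z = x |: (C :\ z).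
  by apply/setP => v; rewrite !inE; case: eqP => [->|]//=; rewrite (negbTE zx).
apply/setP => A; apply/rstP/setU1P => [[B]|].
  rewrite in_setU1 in_setD1 => /orP[/eqP->|/andP[BC BP]] [-> h].
    by rewrite e; left.
  right; rewrite in_setD1; apply/andP; split; last exact: rst_cell.
  by apply: contraNneq BC => /(cellD1_inj pP BP CP h)->.
case=> [->|/setD1P[AC /rstP[B BP [eB A0]]]].
  exists (x |: C); rewrite ?in_setU1 ?eqxx // e; split=> //.
  by apply/set0Pn; exists x; rewrite !inE eqxx.
exists B => //; rewrite in_setU1 in_setD1 BP andbT.
by apply/orP; right; apply: contraNneq AC => <-; rewrite eB.
Qed.

Lemma rst_add_to_id x C P S : partition P S -> x \notin S -> C \in P ->
  rst x (add_to x C P) = P.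
Proof.
move=> pP xS CP.
have xP A : A \in P -> A :\ x = A.
  by move=> AP; apply/setD1_notin; apply: contraNN xS; apply/subsetP; apply: cell_sub pP AP.
have e : (x |: C) :\ x = C by rewrite setU1K // -(xP C CP) !inE eqxx.
apply/setP => A; apply/rstP/idP => [[B]|AP].
  rewrite in_setU1 in_setD1 => /orP[/eqP->|/andP[BC BP]] [-> h].
    by rewrite e.
  by rewrite xP.
have A0 := cell_neq0 pP AP.
case: (eqVneq A C) => [->|AC].
  by exists (x |: C); rewrite ?in_setU1 ?eqxx // e; split=> //; apply: cell_neq0 pP CP.
by exists A; rewrite ?in_setU1 ?in_setD1 ?AC ?AP ?orbT // xP.
Qed.

Lemma add_to_decomp x k S P : x \in S -> P \in stirling k S -> [set x] \notin P ->
  [/\ pblock P x :\ x \in rst x P, P = add_to x (pblock P x :\ x) (rst x P)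
    & {in pblock P x :\ x, forall v, ~~ adj x v}].
Proof.
move=> xS /stirlingP[pP cP iP] xP.
have [CP xC] := cell_pblock pP xS; set C := pblock P x in CP xC *.
have C0 := cellD1_neq0 pP xP CP.
split; first exact: rst_cell.
  apply/setP => A; rewrite in_setU1 in_setD1 setD1K //.
  case: eqVneq => [->|AC] /=; first by rewrite CP.
  apply/idP/andP => [AP|[ACx /rstP[B BP [eA A0]]]].
    have xA : x \notin A.
      by apply: contraNN AC => xA; rewrite (cell_eq pP AP CP xA xC).
    rewrite -[in A \in rst _ _](setD1_notin xA).
    split; last by apply: rst_cell (cellD1_neq0 pP xP AP).
    apply: contraNneq AC; rewrite -{1}(setD1_notin xA) => /(cellD1_inj pP AP CP)->//.
    exact: cellD1_neq0 pP xP AP.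
  rewrite eA setD1_notin //; apply: contraNN ACx => xB.
  by rewrite eA (cell_eq pP BP CP xB xC).
move=> v; rewrite inE => /andP[_ vC]; have /indepP := iP C CP.
by apply.
Qed.

Lemma pblock_add_to x C P S : partition P S -> x \notin S -> C \in P ->
  partition (add_to x C P) (x |: S) -> pblock (add_to x C P) x :\ x = C.
Proof.
move=> pP xS CP /and3P[_ tP _].
rewrite (def_pblock tP (_ : x |: C \in _)) ?setU11 ?inE ?eqxx //.
by rewrite setU1K //; apply: contraNN xS; apply/subsetP; apply: cell_sub pP CP.
Qed.

Lemma add_to_inj x P S C D : partition P S -> x \notin S -> C \in P -> D \in P ->
  add_to x C P = add_to x D P -> C = D.
Proof.
move=> pP xS CP DP e.
have xP A : A \in P -> x \notin A.
  by move=> AP; apply: contraNN xS; apply/subsetP; apply: cell_sub pP AP.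
have: x |: C \in add_to x D P by rewrite -e in_setU1 eqxx.
rewrite in_setU1 in_setD1 => /orP[/eqP h|/andP[_ /xP]]; last by rewrite !inE eqxx.
by rewrite -(setU1K (xP C CP)) h setU1K // xP.
Qed.

Lemma add_single_decomp x k S P : P \in stirling k.+1 S -> [set x] \in P ->
  P = add_single x (P :\ [set x]) /\ P :\ [set x] \in stirling k (S :\ x).
Proof.
move=> /stirlingP[pP cP iP] xP; split; first by rewrite /add_single setD1K.
apply/stirlingP; split; last 2 first.
- by move: cP; rewrite (cardsD1 [set x]) xP => -[].
- by move=> A; rewrite inE => /andP[_ /iP].
apply: partitionI => [A|v|A B v].
- rewrite !inE => /andP[Ax AP]; split; first exact: cell_neq0 pP AP.
  rewrite subsetD1 (cell_sub pP AP); apply: contraNN Ax => xA.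
  by rewrite (cell_eq pP AP xP xA) // inE.
- rewrite !inE => /andP[vx /(cell_pblock pP)[BP vB]].
  exists (pblock P v) => //; rewrite !inE BP andbT.
  by apply: contraNneq vx => e; move: vB; rewrite e inE.
- by rewrite !inE => /andP[_ AP] /andP[_ BP]; apply: cell_eq pP AP BP.
Qed.

(** With as many cells as vertices, all cells have one element, because their
    cardinals are positive and have [k] as their sum. *)
Lemma singles_stirling k S : #|S| = k -> stirling k S = [set [set [set v] | v in S]].
Proof.
move=> cS; have inj : {in S &, injective (fun v : G => [set v])} by move=> u v _ _ /set1_inj.
have sin : [set [set v] | v in S] \in stirling k S.
  apply/stirlingP; split; last 2 first.
  - by rewrite card_in_imset.
  - move=> _ /imsetP[v _ ->]; apply/indepP => a b; rewrite !inE => /eqP-> /eqP->.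
    by rewrite adj_irr.
  apply: partitionI => [_ /imsetP[v vS ->]|v vS|A1 B1 v].
  - by rewrite -card_gt0 cards1 sub1set.
  - by exists [set v]; [apply/imsetP; exists v|rewrite inE].
  - by move=> /imsetP[a _ ->] /imsetP[b _ ->]; rewrite !inE => /eqP<- /eqP<-.
apply/setP => P; apply/idP/set1P => [|->//].
move=> /stirlingP[pP cP iP]; apply/eqP; rewrite eq_sym eqEcard; apply/andP; split; last first.
  by rewrite card_in_imset // cS cP.
have h : \sum_(A in P) #|A| = \sum_(A in P) 1.
  by rewrite sum1_card cP -cS (card_partition pP).
have c1 A : A \in P -> #|A| = 1.
  move=> AP; have ge1 B : B \in P -> 1 <= #|B| by move/(cell_neq0 pP); rewrite card_gt0.
  have [_] := leqif_sum (fun B (BP : B \in P) => leqif_eq (ge1 B BP)).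
  by rewrite h eqxx => /esym/forall_inP/(_ A AP)/eqP.
apply/subsetP => _ /imsetP[v vS ->].
have [BP vB] := cell_pblock pP vS.
have /eqP/cards1P[u e] := c1 _ BP.
by move: vB BP; rewrite e inE => /eqP->.
Qed.

End Partitions.

(** * Leaves of subtrees *)

Section Trees.

Variable G : sgraph.
Implicit Types (S A B : {set G}) (x y z t v : G).

(** Connectedness in terms of cuts: it passes to the complement of a leaf without
    any surgery on paths. *)
Definition connected_on S : Prop :=
  S != set0 /\ forall A, A \subset S -> A != set0 -> A != S ->
    exists a b, [/\ a \in A, b \in S, b \notin A & adj a b].

Definition leaf S x y : Prop :=
  [/\ x \in S, y \in S, y != x & {in S, forall v, adj x v = (v == y)}].

Lemma connected_onT : connected G -> connected_on [set: G].
Proof.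
move=> [G0 cG]; split; first by rewrite -card_gt0 cardsT.
move=> A _ /set0Pn[a aA] AT.
have [b bA] : exists b, b \notin A.
  apply/existsP; apply: contraNT AT => /existsPn h.
  by apply/eqP/setP => v; rewrite inE; apply: negbNE (h v).
have /existsP[u /existsP[v /and3P[uA vA uv]]] :
    [exists u, exists v, [&& u \in A, v \notin A & adj u v]].
  apply: contraNT bA => /existsPn h.
  have cA : closed (@adj G) (mem A).
    apply: intro_closed; first exact: sym_connect_sym (@adj_sym G).
    move=> u v uv uA; apply: negbNE; apply/negP => vA.
    by have /existsPn/(_ v) := h u; rewrite uA uv vA.
  by rewrite -[b \in A](closed_connect cA (cG a b)).
by exists u, v; split=> //; rewrite inE.
Qed.

(** A cut of [S :\ x] extends to a cut of [S] with [x] on the side of its only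
    neighbour, and the edge that crosses the latter does not involve [x]. *)
Lemma leaf_connected_on S x y :
  connected_on S -> leaf S x y -> connected_on (S :\ x).
Proof.
move=> [_ cS] [xS yS yx xy]; split; first by apply/set0Pn; exists y; rewrite !inE yx.
move=> A /subsetP sA A0 AS.
have xA : x \notin A by apply/negP => /sA; rewrite !inE eqxx.
have AsS : A \subset S by apply/subsetP => v /sA; rewrite inE => /andP[].
case: (boolP (y \in A)) => yA.
  have [|||a [b [aA bS bA ab]]] := cS (x |: A).
  - by rewrite subUset sub1set xS AsS.
  - by apply/set0Pn; exists x; rewrite setU11.
  - by apply: contraNneq AS => <-; rewrite setU1K.
  move: bA; rewrite in_setU1 negb_or => /andP[bx bA].
  move: aA; rewrite in_setU1 => /orP[/eqP ax|aA].
    by move: ab; rewrite ax xy // => /eqP by_; rewrite by_ yA in bA.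
  by exists a, b; split=> //; rewrite !inE bx.
have [||a [b [aA bS bA ab]]] := cS A AsS => //.
  by apply: contraNneq yA => ->.
exists a, b; split=> //; rewrite !inE bS andbT.
apply: contraNneq yA => bx; move: ab; rewrite bx adj_sym xy; last by move/subsetP: AsS; apply.
by move=> /eqP<-.
Qed.

(** The end of a longest simple path issued from t is a leaf: a further
    neighbour would either prolong the path or close a cycle with it. *)
Lemma leaf_exists S t : acyclic G -> connected_on S -> t \in S -> 1 < #|S| ->
  exists x y, [/\ leaf S x y, x != t
    & y = t -> {in S :\ t, forall v, adj t v}].
Proof.
move=> acG [_ cS] tS S1.
pose good n := [exists p : n.-tuple G,
  [&& path (@adj G) t p, uniq (t :: p) & all (mem S) p]].
have ex1 p : path (@adj G) t p -> uniq (t :: p) -> all (mem S) p -> good (size p).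
  by move=> h1 h2 h3; apply/existsP; exists (in_tuple p); rewrite h1 h2.
have ex0 : exists n, good n by exists 0; apply: (ex1 [::]).
have bnd n : good n -> n <= #|G|.
  move=> /existsP[p /and3P[_ /card_uniqP h _]].
  have := max_card (mem (t :: p)); rewrite h /= size_tuple; exact: leq_trans.
case: (ex_maxnP ex0 bnd) => n /existsP[[p /= /eqP sp] /and3P[/= pp /andP[tp up] Sp]] nmax.
have step (a b : G) : adj a b -> b != a.
  by move=> ab; apply: contraTneq ab => ->; rewrite adj_irr.
have [a [b [/set1P-> bS _ tb]]] : exists a b, [/\ a \in [set t], b \in S, b \notin [set t] & adj a b].
  apply: cS; rewrite ?sub1set //; first by rewrite -card_gt0 cards1.
  by apply: contraTneq S1 => <-; rewrite cards1.
have n1 : 0 < n.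
  apply: (nmax 1); apply: (ex1 [:: b]); rewrite /= ?tb ?bS // inE andbT eq_sym.
  exact: step tb.
have [q [x pE]] : exists q x, p = rcons q x.
  by case/lastP: p sp {pp tp up Sp} n1 => [<-//|q x _ _]; exists q, x.
move: sp pp tp up Sp; rewrite {p}pE size_rcons rcons_path mem_rcons inE negb_or
  rcons_uniq all_rcons => sp /andP[pq yx] /andP[tx tq] /andP[xq uq] /andP[/= xS qS].
set y := last t q in yx.
have yS : y \in S.
  have: y \in t :: q by apply: mem_last.
  by rewrite inE => /orP[/eqP->//|]; apply/allP.
have nbx v : v \in S -> adj x v -> v = y.
  move=> vS xv.
  have: v \in t :: rcons q x.
    apply/negPn/negP => vp.
    have: n.+1 <= n.
      apply: nmax; rewrite -sp -(size_rcons q x) -(size_rcons _ v).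
      apply: ex1; rewrite ?rcons_path ?last_rcons ?pq ?xv ?yx //=.
        move: vp; rewrite inE negb_or => /andP[vt vp].
        by rewrite mem_rcons inE negb_or eq_sym vt mem_rcons inE negb_or tx tq !rcons_uniq vp xq uq.
      by rewrite !all_rcons /= vS xS.
    by rewrite ltnn.
  rewrite -rcons_cons mem_rcons inE => /orP[/eqP vx|].
    by move: xv; rewrite vx adj_irr.
  move=> vq; have [i iq vE] : exists2 i, i < size (t :: q) & v = nth t (t :: q) i.
    by exists (index v (t :: q)); rewrite ?index_mem ?nth_index.
  pose c := drop i (t :: q).
  have cE : c = v :: drop i q.
    by rewrite /c (drop_nth t) // -vE.
  have lc : last v (drop i q) = y.
    have: last t (drop i (t :: q)) = y.
      rewrite /y -[last t q]/(last t (t :: q)) -{2}(cat_take_drop i (t :: q)) last_cat.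
      by rewrite -/c cE.
    by rewrite -/c cE.
  (* If [v] is not the predecessor of [x], the end of the path closes a cycle. *)
  apply/eqP; case: (posnP (size (drop i q))) => [/size0nil h|h].
    by move: lc; rewrite h /= => ->.
  case: (acG (rcons c x)); split; first by rewrite size_rcons cE /= ltnS ltnS.
  apply/andP; split.
    rewrite cE rcons_cons /= !rcons_path last_rcons xv lc yx !andbT.
    move: pq; rewrite -{1}(cat_take_drop i q) cat_path => /andP[_].
    have -> : last t (take i q) = v.
      rewrite vE; case: (i) iq => [|j] /= iq; first by rewrite take0.
      by rewrite (take_nth t) // last_rcons.
    by [].
  rewrite rcons_uniq drop_uniq /= ?tq ?uq // andbT.
  apply/negP => /mem_drop; rewrite inE => /orP[/eqP xt|]; last exact/negP.
  by rewrite xt eqxx in tx.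
exists x, y; split.
- split=> //; first by rewrite eq_sym step.
  move=> v vS; apply/idP/eqP => [|->]; first exact: nbx.
  by rewrite adj_sym.
- by rewrite eq_sym.
- move=> yt v; rewrite in_setD1 => /andP[vt vS].
  have q0 : q = [::].
    case/lastP: q @y yt tq {nbx sp pq xq uq qS yS yx} => // q z /=.
    by rewrite last_rcons mem_rcons inE => ->; rewrite eqxx.
  have sn : n = 1 by rewrite -sp q0.
  apply: negbNE; apply/negP => ntv.
  pose A := t |: [set w in S | adj t w].
  have vA : v \notin A by rewrite !inE (negbTE vt) (negbTE ntv) andbF.
  have [|||a' [b' [aA bS' bA ab]]] := cS A.
  - by rewrite subUset sub1set tS; apply/subsetP => w; rewrite inE => /andP[].
  - by apply/set0Pn; exists t; rewrite setU11.
  - by apply: contraNneq vA => ->.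
  move: bA; rewrite !inE bS' /= negb_or => /andP[bt tb'].
  move: aA; rewrite !inE => /orP[/eqP at_|/andP[aS ta]]; first by rewrite -at_ ab in tb'.
  have: 2 <= n.
    apply: nmax; apply: (ex1 [:: a'; b']); rewrite /= ?ta ?ab ?aS ?bS' //.
    rewrite !inE negb_or [t == b']eq_sym bt !andbT /=.
    by rewrite [t == a']eq_sym (step _ _ ta) [a' == b']eq_sym (step _ _ ab).
  by rewrite sn.
Qed.

End Trees.

(** * Traversals and clique blow-ups *)

Section Traversals.

Variables (T : finType) (e : rel T).
Implicit Types (A B : {set T}) (a b c d : T).

(** A Hamiltonian path of the subgraph induced on [A], from [a] to [b]. *)
Definition traversal A a b : Prop :=
  exists s, [/\ path e a s, last a s = b, uniq (a :: s) & a :: s =i A].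

Lemma traversal_mem A a b : traversal A a b -> a \in A /\ b \in A.
Proof.
move=> [s [_ lb _ m]]; split; rewrite -m; first by rewrite inE eqxx.
by rewrite -lb mem_last.
Qed.

Lemma traversal1 a : traversal [set a] a a.
Proof. by exists [::]; split=> // v; rewrite !inE. Qed.

Lemma traversal_cat A B a b c d : [disjoint A & B] ->
  traversal A a b -> e b c -> traversal B c d -> traversal (A :|: B) a d.
Proof.
move=> dAB [s [ps ls us ms]] bc [t [pt lt ut mt]].
exists (s ++ c :: t); split.
- by rewrite cat_path ps ls /= bc pt.
- by rewrite last_cat /= lt.
- rewrite -cat_cons cat_uniq us ut andbT; apply/hasPn => v.
  rewrite mt /= -topredE /= ms => vB.
  by rewrite (disjointFl dAB).
- by move=> v; rewrite -cat_cons mem_cat ms mt inE.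
Qed.

Lemma traversal_rev A a b : symmetric e -> traversal A a b -> traversal A b a.
Proof.
move=> se [s [ps ls us ms]].
have rE : b :: rev (belast a s) = rev (a :: s) by rewrite (lastI a s) rev_rcons ls.
exists (rev (belast a s)); split.
- by rewrite -ls rev_path; apply: sub_path ps => u v /=; rewrite se.
- by case: s ls {ps us ms rE} => //= v s _; rewrite rev_cons last_rcons.
- by rewrite rE rev_uniq.
- by move=> v; rewrite rE mem_rev ms.
Qed.

Lemma traversal_clique A a b : {in A &, forall c d, c != d -> e c d} ->
  a \in A -> b \in A -> a != b -> traversal A a b.
Proof.
move=> cl aA bA ab.
have pth : forall s c, uniq (c :: s) -> {subset c :: s <= A} -> path e c s.
  elim=> //= d s ih c /andP[cds uds] sA.
  rewrite ih // ?andbT; last by move=> v vs; apply: sA; rewrite inE vs orbT.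
  apply: cl; rewrite ?sA ?inE ?eqxx ?orbT //.
  by apply: contraNneq cds => ->; rewrite inE eqxx.
pose s := rcons (enum (A :\ a :\ b)) b.
have ms : a :: s =i A.
  move=> v; rewrite inE mem_rcons inE mem_enum !inE.
  by case: eqVneq => [->|_] //=; case: eqVneq => [->|].
have us : uniq (a :: s).
  rewrite /= mem_rcons inE mem_enum !inE eqxx !andbF orbF ab.
  by rewrite rcons_uniq mem_enum !inE eqxx enum_uniq.
exists s; split=> //; last by rewrite last_rcons.
by apply: pth => // v; rewrite ms.
Qed.

End Traversals.

Lemma traversal_map (T U : finType) (e : rel T) (e' : rel U) (f : T -> U)
    (A : {set T}) (a b : T) :
  {in A &, injective f} -> {in A &, forall c d, e c d -> e' (f c) (f d)} ->
  traversal e A a b -> traversal e' (f @: A) (f a) (f b).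
Proof.
move=> fi fe [s [ps ls us ms]].
have sA : {subset a :: s <= A} by move=> v; rewrite ms.
exists (map f s); split.
- have : {subset a :: s <= A} := sA.
  elim: (s) (a) ps => //= d t ih c /andP[cd dt] h.
  rewrite fe ?h ?inE ?eqxx ?orbT //= ih // => v vt.
  by apply: h; rewrite inE vt orbT.
- by rewrite last_map ls.
- rewrite -map_cons map_inj_in_uniq // => c d cs ds.
  by apply: fi; apply: sA.
- move=> v; rewrite -map_cons; apply/mapP/imsetP => -[w ws ->]; exists w => //.
    exact: sA.
  by rewrite ms.
Qed.

Section BlowUp.

Variables (T B : finType) (C : eqType) (e : rel T) (r : rel B).
Variables (K : B -> {set T}) (phi : B -> C).

(** The places at which the clique [K p'] can be entered from [A]. *)
Definition exits p' (A : {set T}) := [set Q in K p' | [exists P in A, e P Q]].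
Definition blowup (s : seq B) : {set T} := [set P | has (fun p => P \in K p) s].

Hypothesis e_sym : symmetric e.
Hypothesis K_disjoint : forall p p', p != p' -> [disjoint K p & K p'].
Hypothesis K_clique : forall p, {in K p &, forall P Q, P != Q -> e P Q}.
Hypothesis r_exits : forall p p' (A : {set T}), r p p' -> A \subset K p ->
  #|A| <= #|exits p' A|.+1 /\ (phi p != phi p' -> #|A| <= #|exits p' A|).

Lemma blowup_rcons s p : blowup (rcons s p) = blowup s :|: K p.
Proof. by apply/setP => P; rewrite !inE has_rcons orbC. Qed.

Lemma blowup_disjoint s p : p \notin s -> [disjoint blowup s & K p].
Proof.
move=> ps; rewrite disjoint_subset; apply/subsetP => P; rewrite inE => /hasP[q qs Pq].
rewrite inE /=; rewrite (disjointFr (K_disjoint _) Pq) //.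
by apply: contraNneq ps => <-.
Qed.

(** By induction on the path, all vertices of the last clique but one are possible
    ends of a traversal that starts at [P].  A single entrance to the next clique
    makes all its other vertices possible ends, two entrances make all of them
    possible; and once all are possible, this persists.  Two entrances exist as
    soon as [phi] changes once. *)
Lemma blowup_path p s P :
  P \in K p -> path r p s -> uniq (p :: s) -> {in p :: s, forall q, 2 < #|K q|} ->
  exists E : {set T}, [/\ E \subset K (last p s),
    {in E, forall D, traversal e (blowup (p :: s)) P D},
    #|K (last p s)| <= #|E|.+1
    & E = K (last p s) \/ {in p :: s, forall q, phi q = phi p}].
Proof.
elim/last_ind: s => [|s p' IH] PK.
  move=> _ _ _; exists (K p :\ P); split.
  - exact: subD1set.
  - move=> D; rewrite !inE => /andP[DP DK].
    have -> : blowup [:: p] = K p by apply/setP => Q; rewrite !inE /= orbF.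
    by apply: traversal_clique (@K_clique p) PK DK _; rewrite eq_sym.
  - by rewrite (cardsD1 P) PK.
  - by right=> q; rewrite inE => /eqP->.
rewrite rcons_path -rcons_cons rcons_uniq last_rcons => /andP[ps rp'] /andP[p's us] K3.
have {IH}[|E [EK Et cE EK']] := IH PK ps us.
  by move=> q qs; apply: K3; rewrite mem_rcons inE qs orbT.
have lK : 2 < #|K (last p s)| by apply: K3; rewrite mem_rcons inE mem_last orbT.
have p'K : 2 < #|K p'| by apply: K3; rewrite mem_rcons inE eqxx.
have [h1 h2] := r_exits rp' EK.
have through Q D : Q \in exits p' E -> D \in K p' -> Q != D ->
    traversal e (blowup (rcons (p :: s) p')) P D.
  rewrite inE => /andP[QK /exists_inP[F FE FQ]] DK QD.
  rewrite blowup_rcons; apply: traversal_cat (Et F FE) FQ _.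
    exact: blowup_disjoint.
  exact: traversal_clique (@K_clique p') QK DK QD.
have [N2|N1] := ltnP 1 #|exits p' E|.
  exists (K p'); split=> //; last by left.
  move=> D DK; have /card_gt0P[Q] : 0 < #|exits p' E :\ D|.
    by move: N2; rewrite (cardsD1 D); case: (D \in _) => //; apply: ltnW.
  rewrite in_setD1 => /andP[QD QN]; exact: through QN DK QD.
have E1 : 1 < #|E| by rewrite -ltnS; apply: leq_trans lK cE.
have /card_gt0P[Q QN] : 0 < #|exits p' E| by rewrite -ltnS; apply: leq_trans E1 h1.
have QK : Q \in K p' by move: QN; rewrite inE => /andP[].
exists (K p' :\ Q); split.
- exact: subD1set.
- by move=> D; rewrite in_setD1 => /andP[DQ DK]; apply: through QN DK _; rewrite eq_sym.
- by rewrite (cardsD1 Q) QK.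
- right; case: EK' => [EK'|phis].
    by move: lK; rewrite -EK' => /leq_trans/(_ h1); rewrite ltnS ltnNge N1.
  have eqphi : phi (last p s) = phi p'.
    by apply/eqP; apply: contraTT N1 => /h2 h; rewrite -ltnNge; apply: leq_trans E1 h.
  move=> q; rewrite mem_rcons inE => /orP[/eqP->|/phis//].
  by rewrite -eqphi phis // mem_last.
Qed.

(** The first clique is left from a vertex [c] different from the prescribed ends
    and entered again at the end of the tour: part of it is used on departure,
    and the rest on return.  Two entrances are available for the return, as [phi]
    is not constant, and one of them is not [c]. *)
Lemma blowup_cycle p0 p s a b c Q :
  a \in K p0 -> b \in K p0 -> c \in K p0 -> a != b -> c != a -> c != b ->
  Q \in K p -> e c Q ->
  path r p s -> r (last p s) p0 -> uniq [:: p0, p & s] ->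
  {in [:: p0, p & s], forall q, 2 < #|K q|} ->
  (exists2 q, q \in p :: s & phi q != phi p0) ->
  traversal e (blowup [:: p0, p & s]) a b.
Proof.
move=> aK bK cK ab ca cb QK cQ ps rp0 /andP[p0s us] K3 [q qs phiq].
have K3s : {in p :: s, forall q, 2 < #|K q|} by move=> q' h; apply: K3; rewrite inE h orbT.
have [E [EK Et cE EK']] := blowup_path QK ps us K3s.
have lK : 2 < #|K (last p s)| by apply: K3s; rewrite mem_last.
have [h1 h2] := r_exits rp0 EK.
have N2 : 1 < #|exits p0 E|.
  case: EK' => [EK'|phis]; first by rewrite -ltnS; apply: leq_trans h1; rewrite EK'.
  apply: leq_trans (h2 _); first by rewrite -ltnS; apply: leq_trans lK cE.
  by rewrite phis ?mem_last // -(phis q).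
have /card_gt0P[D] : 0 < #|exits p0 E :\ c|.
  by move: N2; rewrite (cardsD1 c); case: (c \in _) => //; apply: ltnW.
rewrite in_setD1 inE => /and3P[Dc DK /exists_inP[F FE FD]].
have wlog_b a' b' : a' \in K p0 -> b' \in K p0 -> a' != b' -> c != a' -> c != b' -> D != a' ->
    traversal e (blowup [:: p0, p & s]) a' b'.
  move=> a'K b'K ab' ca' cb' Da'.
  have -> : blowup [:: p0, p & s] = (K p0 :\: [set D; b'] :|: blowup (p :: s)) :|: [set D; b'].
    apply/setP => P; rewrite !inE /=.
    case: eqVneq => [->|_] /=; first by rewrite DK orbT.
    case: eqVneq => [->|_] /=; first by rewrite b'K orbT.
    by rewrite orbF.
  have dj : [disjoint K p0 & blowup (p :: s)] by rewrite disjoint_sym blowup_disjoint.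
  have sD : [set D; b'] \subset K p0 by rewrite subUset !sub1set DK b'K.
  apply: traversal_cat (_ : traversal e _ _ F) FD _.
  - rewrite disjoint_subset; apply/subsetP => P; rewrite in_setU in_setD !inE /= -in_set2.
    case/orP => [/andP[]//|PU]; apply: contraTN (PU) => /(subsetP sD) PK.
    have: P \notin blowup (p :: s) by rewrite (disjointFr dj PK).
    by rewrite inE.
  - apply: traversal_cat (_ : traversal e _ a' c) cQ (Et F FE).
      by apply: disjointWl dj; apply: subsetDl.
    apply: traversal_clique; rewrite ?inE ?negb_or ?a'K ?cK ?ab' ?cb' ?andbT //; last by rewrite eq_sym.
    + by move=> P P'; rewrite !in_setD => /andP[_ h] /andP[_ h']; apply: K_clique h h'.
    + by rewrite eq_sym.
    + by rewrite eq_sym.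
  - case: (eqVneq D b') => [->|Db']; first by rewrite setUid; apply: traversal1.
    apply: traversal_clique; rewrite ?inE ?eqxx ?orbT //.
    by move=> P P' h h'; apply: K_clique; apply: (subsetP sD).
case: (eqVneq D a) => [Da|]; last exact: wlog_b.
apply: traversal_rev => //; apply: wlog_b => //; first by rewrite eq_sym.
by rewrite Da.
Qed.

End BlowUp.

(** * Extending a tree by a leaf *)

Section LeafExtension.

Variables (G : sgraph) (S : {set G}) (x y : G).
Hypotheses (xS : x \notin S) (yS : y \in S).
Hypothesis x_leaf : {in S, forall v, adj x v = (v == y)}.
Implicit Types (A B C D : {set G}) (P Q p q : {set {set G}}) (z u v w t : G).

(** A singleton cell cannot be moved elsewhere without changing the number of
    cells. *)
Lemma move_cell k p q z : p \in stirling k S -> q \in stirling k S -> p != q ->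
  rst z p = rst z q -> z \in S /\ [set z] \notin p.
Proof.
move=> pk qk pq e; have [pP cp _] := stirlingP _ _ _ pk; have [qP cq _] := stirlingP _ _ _ qk.
have zS : z \in S.
  by apply: contraNT pq => zS; rewrite -(rst_id pP zS) e (rst_id qP zS).
split=> //; apply/negP => zp.
case: k pk qk cp cq => [|k] pk qk cp cq.
  by move/eqP: cp; rewrite cards_eq0 => /eqP p0; rewrite p0 inE in zp.
have [pE p'k] := add_single_decomp pk zp.
have p'P : partition (p :\ [set z]) (S :\ z) by have [] := stirlingP _ _ _ p'k.
have rp : rst z p = p :\ [set z] by rewrite {1}pE (rst_add_single_id p'P) // !inE eqxx.
case: (boolP ([set z] \in q)) => zq.
  have [qE q'k] := add_single_decomp qk zq.
  have q'P : partition (q :\ [set z]) (S :\ z) by have [] := stirlingP _ _ _ q'k.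
  have rq : rst z q = q :\ [set z] by rewrite {1}qE (rst_add_single_id q'P) // !inE eqxx.
  by move/eqP: pq; apply; rewrite pE qE -rp -rq e.
have := rst_card qP zq; rewrite -e cq rp; have [_ -> _] := stirlingP _ _ _ p'k.
by move/eqP; rewrite eqn_leq ltnn andbF.
Qed.

Variable r : nat.

(** The clique of all placements of [x] above [p]. *)
Definition fibre p : {set {set {set G}}} :=
  [set P in stirling r.+1 (x |: S) | rst x P == p].

Lemma fibre_rst p P : P \in fibre p -> rst x P = p.
Proof. by rewrite inE => /andP[_ /eqP]. Qed.

Lemma in_fibre p P : p \in stirling r.+1 S ->
  reflect (exists2 C, C \in p & y \notin C /\ P = add_to x C p) (P \in fibre p).
Proof.
move=> pr; have [pP cp ip] := stirlingP _ _ _ pr.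
apply: (iffP idP) => [|[C Cp [yC ->]]].
  rewrite inE => /andP[Pr /eqP rP].
  have xP : [set x] \notin P.
    apply/negP => xP; have [PE P'r] := add_single_decomp Pr xP.
    have [P'P cP' _] := stirlingP _ _ _ P'r.
    have := cp; rewrite -rP PE (rst_add_single_id P'P) ?cP' ?inE ?eqxx //.
    by move/eqP; rewrite eqn_leq ltnn andbF.
  have [CP PE nC] := add_to_decomp (setU11 x S) Pr xP.
  exists (pblock P x :\ x); rewrite -rP //; split=> //.
  by apply/negP => /nC; rewrite x_leaf ?eqxx.
have nC : {in C, forall v, ~~ adj x v}.
  move=> v vC; rewrite x_leaf; last by move: v vC; apply/subsetP; apply: cell_sub pP Cp.
  by apply: contraNneq yC => <-.
by rewrite inE (add_to_stirling xS pr Cp nC) (rst_add_to_id pP xS Cp) /=.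
Qed.

Lemma fibre_card p : p \in stirling r.+1 S -> #|fibre p| = r.
Proof.
move=> pr; have [pP cp ip] := stirlingP _ _ _ pr.
have [yp yy] := cell_pblock pP yS.
have -> : fibre p = [set add_to x C p | C in p :\ pblock p y].
  apply/setP => P; apply/idP/imsetP => [/(in_fibre _ pr)[C Cp [yC ->]]|[C]].
    exists C => //; rewrite !inE Cp andbT.
    by apply: contraNneq yC => ->.
  move=> /setD1P[Cy Cp] ->; apply/(in_fibre _ pr); exists C => //; split=> //.
  by apply: contraNN Cy => yC; apply/eqP; apply: cell_eq pP Cp yp yC yy.
rewrite card_in_imset; last first.
  by move=> C D /setD1P[_ Cp] /setD1P[_ Dp]; apply: (add_to_inj pP xS).
by move: cp; rewrite (cardsD1 (pblock p y)) yp => -[].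
Qed.

Lemma fibre_disjoint p q : p != q -> [disjoint fibre p & fibre q].
Proof.
move=> pq; rewrite disjoint_subset; apply/subsetP => P; rewrite !inE => /andP[-> /eqP->].
by rewrite /= (negbTE pq).
Qed.

Lemma fibre_clique p : {in fibre p &, forall P Q, P != Q -> padj P Q}.
Proof.
move=> P Q; rewrite !inE => /andP[_ /eqP eP] /andP[_ /eqP eQ] PQ.
by apply: (padjI (x := x)) => //; rewrite eP eQ.
Qed.

(** Moving a vertex [z] of the smaller tree can be done below [P] without
    touching the leaf, unless [z] is the neighbour of the leaf and moves into
    the very cell that houses the leaf. *)
Lemma fibre_move p q z P : p \in stirling r.+1 S -> q \in stirling r.+1 S ->
  p != q -> rst z p = rst z q -> P \in fibre p ->
  (exists2 Q, Q \in fibre q & rst z Q = rst z P) \/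
  (rst y p = rst y q /\ q = add_to y (pblock P x :\ x) (rst y p)).
Proof.
move=> pr qr pq e PK.
have [pP cp ip] := stirlingP _ _ _ pr; have [qP cq iq] := stirlingP _ _ _ qr.
have [zS zp] := move_cell pr qr pq e.
have [_ zq] : z \in S /\ [set z] \notin q by apply: (move_cell qr pr) => //; rewrite eq_sym.
have zx : z != x by apply: contraNneq xS => <-.
have /(in_fibre _ pr)[C Cp [yC PE]] := PK.
have : C :\ z \in rst z q by rewrite -e; apply: rst_cell => //; apply: cellD1_neq0 pP zp Cp.
case/rstP => C' Cq [eC _].
case: (boolP (y \in C')) => yC'; last first.
  left; exists (add_to x C' q); first by apply/(in_fibre _ qr); exists C'.
  by rewrite PE (rst_add_to qP zx xS Cq) (rst_add_to pP zx xS Cp) e eC.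
have yz : z = y.
  apply/eqP; apply: contraNT yC => zy.
  have : y \in C :\ z by rewrite eC in_setD1 yC' eq_sym zy.
  by rewrite in_setD1 => /andP[].
right; subst z; split=> //.
have [Bq yB] := cell_pblock qP yS.
have BE : pblock q y = C' by apply: cell_eq qP Bq Cq yB yC'.
have [Br qE _] := add_to_decomp yS qr zq.
rewrite {1}qE e; congr (add_to y _ _).
have [PP _ _] : [/\ partition P (x |: S), #|P| = r.+1 & {in P, forall A, independent A}].
  by apply/stirlingP; move: PK; rewrite inE => /andP[].
by rewrite PE (pblock_add_to pP xS Cp) -?PE // BE -eC setD1_notin.
Qed.

Definition move_rel : rel {set {set G}} :=
  [rel p q | [&& p \in stirling r.+1 S, q \in stirling r.+1 S & padj p q]].

(** Restriction to the complement of [z] is injective on a fibre, so [fibre_move]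
    provides a matching between two fibres.  It misses at most one vertex, namely
    the one in which the leaf shares the cell that [y] moves to. *)
Lemma fibre_exits p q (A : {set {set {set G}}}) : move_rel p q -> A \subset fibre p ->
  #|A| <= #|exits (@padj G) fibre q A|.+1 /\
  (rst y p != rst y q -> #|A| <= #|exits (@padj G) fibre q A|).
Proof.
move=> /and3P[pr qr /andP[pq /existsP[z /eqP e]]] AK.
have [pP cp ip] := stirlingP _ _ _ pr; have [qP cq iq] := stirlingP _ _ _ qr.
have [zS zp] := move_cell pr qr pq e.
have zx : z != x by apply: contraNneq xS => <-.
pose h P := odflt set0 [pick Q in fibre q | rst z Q == rst z P].
have hP P : (exists2 Q, Q \in fibre q & rst z Q = rst z P) ->
    h P \in fibre q /\ rst z (h P) = rst z P.
  move=> [Q QK eQ]; rewrite /h; case: pickP => [Q' /andP[? /eqP]//|/(_ Q)].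
  by rewrite QK eQ eqxx.
pose good := [set P in A | [exists Q in fibre q, rst z Q == rst z P]].
have goodP P : P \in good -> exists2 Q, Q \in fibre q & rst z Q = rst z P.
  by rewrite inE => /andP[_ /exists_inP[Q QK /eqP eQ]]; exists Q.
have sgood : good \subset A by apply/subsetP => P; rewrite inE => /andP[].
have le_good : #|good| <= #|exits (@padj G) fibre q A|.
  have <- : #|h @: good| = #|good|.
    apply: card_in_imset => P P' Pg P'g eh.
    have {eh} : rst z P = rst z P'.
      by have [_ <-] := hP P (goodP _ Pg); have [_ <-] := hP P' (goodP _ P'g); rewrite eh.
    have /(in_fibre _ pr)[C Cp [_ ->]] : P \in fibre p by apply/(subsetP AK)/(subsetP sgood).
    have /(in_fibre _ pr)[D Dp [_ ->]] : P' \in fibre p by apply/(subsetP AK)/(subsetP sgood).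
    rewrite !(rst_add_to pP zx xS) //.
    have nz B : B \in p -> B :\ z != set0 by apply: cellD1_neq0 pP zp.
    move/(add_to_inj (rst_partition z pP)) => eCD; congr (add_to x _ p).
    apply: (cellD1_inj pP Cp Dp (nz C Cp)); apply: eCD.
    + by rewrite !inE (negbTE xS) andbF.
    + exact: rst_cell (nz C Cp).
    + exact: rst_cell (nz D Dp).
  apply: subset_leq_card; apply/subsetP => _ /imsetP[P Pg ->].
  have [hK he] := hP P (goodP P Pg).
  rewrite inE hK; apply/exists_inP; exists P; first exact: (subsetP sgood).
  apply: (padjI (x := z)) => //.
  move/subsetP: AK => /(_ P (subsetP sgood P Pg)); rewrite inE => /andP[_ /eqP eP].
  by apply: contraNneq pq => eh; move: hK; rewrite -eh inE eP => /andP[].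
have bad P : P \in A :\: good -> rst y p = rst y q /\ q = add_to y (pblock P x :\ x) (rst y p).
  rewrite inE => /andP[Pg PA]; have PK := subsetP AK P PA.
  case: (fibre_move pr qr pq e PK) => // -[Q QK eQ].
  by case/negP: Pg; rewrite inE PA; apply/exists_inP; exists Q => //; apply/eqP.
have badE P : P \in A :\: good -> P = add_to x (pblock q y :\ y) p.
  move=> PB; have [eqy qE] := bad P PB.
  have PK : P \in fibre p by apply: (subsetP AK); move: PB; rewrite inE => /andP[].
  have [PP _ _] : [/\ partition P (x |: S), #|P| = r.+1 & {in P, forall A, independent A}].
    by apply/stirlingP; move: PK; rewrite inE => /andP[].
  have /(in_fibre _ pr)[C Cp [yC PE]] := PK.
  have CE : pblock P x :\ x = C by rewrite PE (pblock_add_to pP xS Cp) // -PE.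
  have Cr : C \in rst y p.
    by rewrite -(setD1_notin yC); apply: rst_cell => //; rewrite setD1_notin //; apply: cell_neq0 pP Cp.
  have -> : pblock q y :\ y = C.
    rewrite qE CE; apply: (pblock_add_to (rst_partition y pP)) => //; first by rewrite !inE eqxx.
    by rewrite setD1K // -CE -qE.
  by [].
rewrite -(cardsID good A) (setIidPr sgood); split; last first.
  move=> /eqP ny; rewrite (_ : A :\: good = set0) ?cards0 ?addn0 //.
  by apply/setP => P; rewrite [RHS]inE; apply/negP => /bad[].
rewrite -addn1 leq_add // -[X in _ <= X](cards1 (add_to x (pblock q y :\ y) p)).
by apply: subset_leq_card; apply/subsetP => P /badE ->; rewrite inE.
Qed.

Hypothesis r3 : 2 < r.

Definition cyclic_on k A : Prop := exists s : seq {set {set G}},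
  [/\ cycle (@padj G) s, uniq s, s =i stirling k A & 2 < size s].

(** The vertex [c] from which the fibre of [p] is left must be linked to the next
    fibre.  If it is not, the cycle is run backwards: [c] cannot fail for both
    neighbours of [p], since each of them would then be [p] with [y] moved to the
    cell that houses the leaf in [c]. *)
Lemma fibres_traversal p P P' :
  p \in stirling r.+1 S -> P \in fibre p -> P' \in fibre p -> P != P' ->
  stirling r.+1 S = [set p] \/ cyclic_on r.+1 S ->
  (stirling r.+1 S != [set p] -> exists2 q, q \in stirling r.+1 S & rst y q != rst y p) ->
  traversal (@padj G) [set Q in stirling r.+1 (x |: S) | rst x Q \in stirling r.+1 S] P P'.
Proof.
move=> pr PK P'K PP' cyc nonc.
have [S1|S1] := eqVneq (stirling r.+1 S) [set p].
  have -> : [set Q in stirling r.+1 (x |: S) | rst x Q \in stirling r.+1 S] = fibre p.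
    by apply/setP => Q; rewrite [RHS]inE inE S1 in_set1.
  by apply: traversal_clique (@fibre_clique p) PK P'K PP'.
case: cyc => [/eqP|[s [cs us ms ss]]]; first by rewrite (negbTE S1).
have {nonc} [q0 q0r nq0] := nonc S1.
have [c cK] : exists c, [&& c \in fibre p, c != P & c != P'].
  have : 0 < #|fibre p :\ P :\ P'|.
    have := cardsD1 P (fibre p); rewrite PK fibre_card // add1n => /eqP e1.
    have := cardsD1 P' (fibre p :\ P); rewrite in_setD1 P'K eq_sym PP' add1n => /eqP e2.
    by move: r3; rewrite (eqP e1) (eqP e2) !ltnS.
  by case/card_gt0P => c; rewrite !in_setD1 => /and3P[h1 h2 h3]; exists c; rewrite h1 h2 h3.
have go p1 s1 : cycle (@padj G) [:: p, p1 & s1] -> uniq [:: p, p1 & s1] ->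
    [:: p, p1 & s1] =i stirling r.+1 S -> (exists2 Q, Q \in fibre p1 & padj c Q) ->
    traversal (@padj G) [set Q in stirling r.+1 (x |: S) | rst x Q \in stirling r.+1 S] P P'.
  move=> c1 u1 m1 [Q QK cQ]; case/and3P: cK => cK cP cP'.
  have -> : [set Q in stirling r.+1 (x |: S) | rst x Q \in stirling r.+1 S]
            = blowup fibre [:: p, p1 & s1].
    apply/setP => R; rewrite [RHS]inE inE; apply/andP/hasP => [[RS Rr]|[q qs RK]].
      by exists (rst x R); rewrite ?m1 // inE RS eqxx.
    by move: RK; rewrite inE => /andP[-> /eqP->]; rewrite -m1.
  have : cycle move_rel [:: p, p1 & s1].
    apply: (sub_in_cycle (P := mem (stirling r.+1 S))) c1.
      by move=> a b ar br ab; apply/and3P.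
    by apply/allP => v; rewrite m1.
  rewrite /= rcons_path => /and3P[rp1 ps1 lp].
  apply: (blowup_cycle (r := move_rel) (phi := rst y) (@padj_sym G) fibre_disjoint
    fibre_clique fibre_exits PK P'K cK PP' cP cP' QK cQ ps1 lp u1).
  - by move=> q; rewrite m1 => qr; rewrite fibre_card.
  - exists q0 => //; move: q0r; rewrite -m1 inE => /orP[/eqP qp|//].
    by rewrite qp eqxx in nq0.
have ps : p \in s by rewrite ms.
have [i s' es] := rot_to ps.
have cs' : cycle (@padj G) (p :: s') by rewrite -es rot_cycle.
have us' : uniq (p :: s') by rewrite -es rot_uniq.
have ms' : p :: s' =i stirling r.+1 S by move=> v; rewrite -es mem_rot ms.
have ss' : 2 < size (p :: s') by rewrite -es size_rot.
(* The alternative is the obstruction described in [fibre_move]. *)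
have linked p1 : p1 \in s' -> padj p p1 -> (exists2 Q, Q \in fibre p1 & padj c Q) \/
    p1 = add_to y (pblock c x :\ x) (rst y p).
  move=> p1s pp1; have p1r : p1 \in stirling r.+1 S by rewrite -ms' inE p1s orbT.
  case/andP: (pp1) => np1 /existsP[z /eqP ez]; case/and3P: cK => cK _ _.
  have [[Q QK eQ]|[_ ?]] := fibre_move pr p1r np1 ez cK; [left|by right].
  exists Q => //; apply: (padjI (x := z)) => //.
  by apply: contraNneq np1 => cQ; rewrite -(fibre_rst cK) -(fibre_rst QK) cQ.
case: s' cs' us' ms' ss' linked {es} => [//|p1 s1] cs' us' ms' ss' linked.
have pp1 : padj p p1 by case/andP: cs'.
have [h|p1E] := linked p1 (mem_head _ _) pp1; first exact: (go _ _ cs' us' ms' h).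
have cs2 : cycle (@padj G) (p :: rev (p1 :: s1)).
  rewrite -rev_rcons -rot1_cons rev_cycle rot_cycle.
  by rewrite (eq_cycle (e' := @padj G)) // => a b; rewrite padj_sym.
have us2 : uniq (p :: rev (p1 :: s1)) by move: us'; rewrite /= mem_rev rev_uniq.
have ms2 : p :: rev (p1 :: s1) =i stirling r.+1 S.
  by move=> v; rewrite -ms' inE mem_rev inE.
case/lastP: s1 ss' cs' us' ms' linked cs2 us2 ms2 => [//|s1 p2] _ cs' us' _ linked.
rewrite -rcons_cons rev_rcons => cs2 us2 ms2.
apply: (go _ _ cs2 us2 ms2).
have p2s : p2 \in p1 :: rcons s1 p2 by rewrite inE mem_rcons inE eqxx orbT.
have pp2 : padj p p2 by case/andP: cs2.
have [//|p2E] := linked p2 p2s pp2.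
by move: us'; rewrite p1E -p2E /= mem_rcons inE eqxx andbF.
Qed.

(** A hook records how the ends of a traversal can be joined through a new leaf
    hung at [t]: the end [q] differs from [p] only in the place of [u], and [q']
    only in the place of [w], while [u] and [w] are cells of [p] that can house the
    leaf. *)
Definition hooked k A t q q' : Prop := exists u w p,
  [/\ u != w, u != t, w != t, p \in stirling k.+1 A &
  [/\ [set u] \in p, [set w] \in p, rst u q = p :\ [set u] & rst w q' = p :\ [set w]]].

(** The cycle runs through the partitions with singleton [x] from [add_single x q] to
    [add_single x q'], then through the fibres from [Pw], where the leaf joins [w],
    to [Pu], where it joins [u], and back.  Cut open at its last edge, it is hooked
    by [u] and [x] in the partition [add_single x p]. *)
Lemma leaf_step t q q' : x != t ->
  traversal (@padj G) (stirling r S) q q' -> hooked r S y q q' ->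
  #|S| = r.+1 \/ cyclic_on r.+1 S ->
  (forall p, p \in stirling r.+1 S -> stirling r.+1 S != [set p] ->
    exists2 p', p' \in stirling r.+1 S & rst y p' != rst y p) ->
  exists Q Q', [/\ traversal (@padj G) (stirling r.+1 (x |: S)) Q Q', padj Q' Q,
    hooked r.+1 (x |: S) t Q Q' & cyclic_on r.+1 (x |: S)].
Proof.
move=> xt tr hk cyc nonc.
(* Reversing the path exchanges [u] and [w], at most one of which is [t]. *)
wlog {hk} [u [w [p [[uw uy wy pr [up wp equ eqw]] ut]]]] : q q' tr hk / exists u w p,
   [/\ u != w, u != y, w != y, p \in stirling r.+1 S &
   [/\ [set u] \in p, [set w] \in p, rst u q = p :\ [set u] & rst w q' = p :\ [set w]]] /\ u != t.
  move=> W; have [u [w [p [uw uy wy pr [up wp equ eqw]]]]] := hk.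
  case: (eqVneq u t) => [ut|ut]; last by apply: (W q q') => //; exists u, w, p.
  apply: (W q' q).
  - by apply: traversal_rev tr; apply: padj_sym.
  - by exists w, u, p; split=> //; rewrite eq_sym.
  - by exists w, u, p; split; [split=> //; rewrite eq_sym|rewrite -ut eq_sym].
have [pP cp ip] := stirlingP _ _ _ pr.
have uS : u \in S by rewrite -sub1set; apply: cell_sub pP up.
have wS : w \in S by rewrite -sub1set; apply: cell_sub pP wp.
have ux : u != x by apply: contraNneq xS => <-.
have wx : w != x by apply: contraNneq xS => <-.
pose Pu := add_to x [set u] p; pose Pw := add_to x [set w] p.
have PuK : Pu \in fibre p.
  by apply/(in_fibre _ pr); exists [set u]; rewrite ?inE // eq_sym.
have PwK : Pw \in fibre p.
  by apply/(in_fibre _ pr); exists [set w]; rewrite ?inE // eq_sym.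
have PwPu : Pw != Pu.
  by apply: contraNneq uw => /(add_to_inj pP xS wp up)/set1_inj->.
have cyc' : stirling r.+1 S = [set p] \/ cyclic_on r.+1 S.
  case: cyc => cyc; [left|by right].
  by apply/setP => P; move: pr; rewrite (singles_stirling cyc) !inE => /eqP->.
have T2 := fibres_traversal pr PwK PuK PwPu cyc' (nonc p pr).
have rP Q : Q \in stirling r S -> partition Q S by case/stirlingP.
have T1 : traversal (@padj G) (add_single x @: stirling r S) (add_single x q) (add_single x q').
  apply: traversal_map tr => [P P' Pr P'r e|P P' Pr P'r /andP[nP /existsP[z /eqP e]]].
    by rewrite -(rst_add_single_id (rP P Pr) xS) e (rst_add_single_id (rP P' P'r) xS).
  have [zS _] := move_cell Pr P'r nP e.
  apply: (padjI (x := z)); last by rewrite !rst_add_single ?e //; apply: contraNneq xS => <-.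
  apply: contraNneq nP => eS.
  by rewrite -(rst_add_single_id (rP P Pr) xS) eS (rst_add_single_id (rP P' P'r) xS).
have [qr q'r] := traversal_mem tr.
have single_to_cell P v : P \in stirling r S -> v \in S -> [set v] \in p ->
    rst v P = p :\ [set v] -> padj (add_single x P) (add_to x [set v] p).
  move=> Pr vS vp e; have vx : v != x by apply: contraNneq xS => <-.
  apply: (padjI (x := v)).
    apply: contraTneq pr => eP; rewrite -(rst_add_to_id pP xS vp) -eP (rst_add_single_id (rP P Pr) xS).
    have [_ cP _] := stirlingP _ _ _ Pr.
    by apply/negP => /stirlingP[_ /eqP]; rewrite cP eqn_leq ltnn andbF.
  rewrite rst_add_single // (rst_add_to pP vx xS vp) setDv e.
  have [pE _] := add_single_decomp pr vp.
  rewrite {2}pE (rst_add_single_id (_ : partition _ (S :\ v))) //; last by rewrite !inE eqxx.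
    rewrite /add_to /add_single setU0 [_ :\ set0]setD1_notin //.
    by apply/negP => /setD1P[_ /(cell_neq0 pP)]; rewrite eqxx.
  by have [_ /stirlingP[]] := add_single_decomp pr vp.
have TT : traversal (@padj G) (stirling r.+1 (x |: S)) (add_single x q) Pu.
  have -> : stirling r.+1 (x |: S) = (add_single x @: stirling r S) :|:
     [set Q in stirling r.+1 (x |: S) | rst x Q \in stirling r.+1 S].
    apply/setP => P; rewrite [RHS]in_setU [P \in [set _ in _ | _]]inE.
    apply/idP/orP => [Pr|[/imsetP[Q Qr ->]|/andP[]//]]; last exact: add_single_stirling.
    case: (boolP ([set x] \in P)) => xP.
      have [PE P'r] := add_single_decomp Pr xP; left; apply/imsetP; exists (P :\ [set x]) => //.
      by rewrite setU1K in P'r.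
    by right; rewrite Pr -{1}(setU1K xS); apply: rst_stirling.
  apply: traversal_cat T1 (single_to_cell q' w q'r wS wp eqw) T2.
  rewrite disjoint_subset; apply/subsetP => _ /imsetP[Q Qr ->]; rewrite !inE negb_and.
  apply/orP; right; rewrite (rst_add_single_id (rP Q Qr) xS).
  have [_ cQ _] := stirlingP _ _ _ Qr.
  by apply/negP => /and3P[_ /eqP]; rewrite cQ => /eqP; rewrite eqn_leq ltnn andbF.
have closing : padj Pu (add_single x q) by rewrite padj_sym; apply: single_to_cell.
exists (add_single x q), Pu; split=> //.
- exists u, x, (add_single x p); split=> //; first exact: add_single_stirling.
  split; rewrite ?inE ?eqxx ?up ?orbT //.
  + rewrite rst_add_single // equ; apply/setP => A; rewrite !inE.
    case: eqVneq => [->|_] //=; rewrite andbT; apply/esym/eqP => /setP/(_ x).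
    by rewrite !inE eqxx eq_sym (negbTE ux).
  + rewrite (rst_add_to_id pP xS up) /add_single setU1K //.
    by apply: contraNN xS => xp; rewrite -sub1set; apply: cell_sub pP xp.
- have [s [ps ls us ms]] := TT; exists (add_single x q :: s); split=> //.
    by rewrite /= rcons_path ps ls.
  rewrite -(card_uniqP us); apply: leq_trans r3 _; rewrite -(fibre_card pr).
  by apply: subset_leq_card; apply/subsetP => P /setIdP[Pr _]; move: Pr; rewrite -ms.
Qed.

End LeafExtension.

(** * From three cells to more *)

Section Induction.

Variable G : sgraph.
Hypothesis acG : acyclic G.
Implicit Types (S A B C D : {set G}) (P Q p q : {set {set G}}) (x y z u v w t : G).

Lemma leafD1 S x y : leaf S x y ->
  [/\ x \notin S :\ x, y \in S :\ x, {in S :\ x, forall v, adj x v = (v == y)},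
      x |: (S :\ x) = S & #|S| = #|S :\ x|.+1].
Proof.
move=> [xS yS yx xy]; rewrite !inE eqxx yx yS setD1K // (cardsD1 x S) xS; split=> //.
by move=> v /setD1P[_ /xy].
Qed.

Lemma stirling_nonempty r S : connected_on S -> 0 < r -> r < #|S| ->
  exists p, p \in stirling r.+1 S.
Proof.
move=> + r0; have [n] := ubnP #|S|; elim: n => // n IH in S *.
rewrite ltnS => Sn cS; rewrite leq_eqVlt => /orP[/eqP e|rS].
  by exists [set [set v] | v in S]; rewrite (singles_stirling (esym e)) inE.
have [t tS] : exists t, t \in S by apply/set0Pn; case: cS.
have S1 : 1 < #|S| by apply: leq_trans rS.
have [x [y [lf _ _]]] := leaf_exists acG cS tS S1.
have [xS' yS' xy SE cE] := leafD1 lf.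
have Sn' : #|S :\ x| < n by rewrite -cE.
have rS' : r < #|S :\ x| by rewrite -ltnS -cE.
have [p pr] := IH (S :\ x) Sn' (leaf_connected_on cS lf) rS'.
have /card_gt0P[P] : 0 < #|fibre (S :\ x) x r p| by rewrite (fibre_card xS' yS' xy pr).
by rewrite inE SE => /andP[Pr _]; exists P.
Qed.

(** Two placements of a leaf other than [y] can be told apart without [y]. *)
Lemma restriction_nonconstant r S y p : connected_on S -> 1 < r -> r < #|S| -> y \in S ->
  p \in stirling r.+1 S -> stirling r.+1 S != [set p] ->
  exists2 p', p' \in stirling r.+1 S & rst y p' != rst y p.
Proof.
move=> cS r1 rS yS pr np.
have rS' : r.+1 < #|S|.
  rewrite ltn_neqAle rS andbT; apply: contraNneq np => e.
  by move: pr; rewrite (singles_stirling (esym e)) inE => /eqP->.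
have S1 : 1 < #|S| by apply: leq_trans rS'.
have [x [y' [lf xy _]]] := leaf_exists acG cS yS S1.
have [xS' yS' xl SE cE] := leafD1 lf.
have rS2 : r < #|S :\ x| by rewrite -ltnS -cE.
have [p' p'r] := stirling_nonempty (leaf_connected_on cS lf) (ltnW r1) rS2.
have [p'P _ _] := stirlingP _ _ _ p'r.
have [P [P' [PK P'K PP']]] : exists P P', [/\ P \in fibre (S :\ x) x r p',
    P' \in fibre (S :\ x) x r p' & P != P'].
  have : 1 < #|fibre (S :\ x) x r p'| by rewrite (fibre_card xS' yS' xl p'r).
  by case/card_gt1P => P [P' [? ? ?]]; exists P, P'.
have Pr : P \in stirling r.+1 S by move: PK; rewrite inE SE => /andP[].
have P'r : P' \in stirling r.+1 S by move: P'K; rewrite inE SE => /andP[].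
case: (eqVneq (rst y P) (rst y p)) => [e|]; last by exists P.
exists P' => //; rewrite -e eq_sym; apply: contraNneq PP'.
have /(in_fibre xS' yS' xl _ p'r)[C Cp [_ ->]] := PK.
have /(in_fibre xS' yS' xl _ p'r)[D Dp [_ ->]] := P'K.
have yx : y != x by rewrite eq_sym.
rewrite !(rst_add_to p'P yx xS') // => eI.
have nx A : A \in p' -> x \notin A.
  by move=> Ap; apply: contraNN xS'; apply/subsetP; apply: cell_sub p'P Ap.
have nxy A : A \in p' -> x \notin A :\ y by move=> Ap; rewrite in_setD1 negb_and (nx A Ap) orbT.
have : x |: (C :\ y) \in add_to x (D :\ y) (rst y p') by rewrite -eI in_setU1 eqxx.
rewrite in_setU1 => /orP[/eqP eU|/setD1P[_ /rstP[B Bp [eB _]]]]; last first.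
  by case/negP: (nxy B Bp); rewrite -eB setU11.
have eCD : C :\ y = D :\ y by rewrite -(setU1K (nxy C Cp)) eU setU1K ?nxy.
have [C0|C0] := eqVneq (C :\ y) set0; last by rewrite (cellD1_inj p'P Cp Dp C0 eCD).
have single A : A \in p' -> A :\ y = set0 -> A = [set y].
  move=> Ap /eqP; rewrite setD_eq0 subset1 => /orP[/eqP//|].
  by rewrite (negbTE (cell_neq0 p'P Ap)).
by rewrite (single C) // (single D) // -eCD.
Qed.

Hypothesis hooked3 : forall S t, connected_on S -> 3 < #|S| -> t \in S ->
  exists q q', traversal (@padj G) (stirling 3 S) q q' /\ hooked 3 S t q q'.

(** The leaf is chosen different from [t], and the hook for one cell less is
    required to avoid the neighbour of the leaf. *)
Lemma stirling_cyclic r S t : 2 < r -> connected_on S -> r < #|S| -> t \in S ->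
  (exists q q', traversal (@padj G) (stirling r S) q q' /\ hooked r S t q q') /\
  (3 < r -> cyclic_on r S).
Proof.
elim: r S t => // r IHr S t.
rewrite ltnS leq_eqVlt => /orP[/eqP<-|r3]; first by move=> cS S3 tS; split=> //; apply: hooked3.
have [n] := ubnP #|S|; elim: n S t => // n IHn S t.
rewrite ltnS => Sn cS rS tS.
have S1 : 1 < #|S| by apply: leq_trans rS; rewrite !ltnS; apply: leq_trans r3.
have [x [y [lf xt _]]] := leaf_exists acG cS tS S1.
have [xS' yS' xl SE cE] := leafD1 lf.
have cS' := leaf_connected_on cS lf.
have rS' : r < #|S :\ x| by rewrite -ltnS -cE.
have [[q [q' [tr hk]]] _] := IHr (S :\ x) y r3 cS' rS' yS'.
have cyc : #|S :\ x| = r.+1 \/ cyclic_on r.+1 (S :\ x).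
  move: rS'; rewrite leq_eqVlt => /orP[/eqP<-|rS']; [by left|right].
  have [|_] := IHn (S :\ x) y _ cS' rS' yS'; last by apply; rewrite ltnS; apply: r3.
  by rewrite -cE.
have [|Q [Q' [tr' _ hk' cyc']]] := leaf_step xS' yS' xl r3 xt tr hk cyc.
  by move=> p pr np; apply: restriction_nonconstant => //; apply: ltnW.
by rewrite SE in tr' hk' cyc'; split=> //; exists Q, Q'.
Qed.

End Induction.

(** * Three-colourings with a pinned edge *)

Notation colour := (option bool).

(** The third colour, when [k] and [i] differ. *)
Definition other_colour (k i : colour) : colour :=
  match k, i with
  | Some b, None | None, Some b => Some (~~ b)
  | _, _ => None
  end.

(** The cyclic order of the colours orients every properly coloured edge. *)
Definition succ_colour (k : colour) : colour :=
  match k with Some false => Some true | Some true => None | None => Some false end.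

Lemma other_colour_l k i : i != k -> other_colour k i != k.
Proof. by case: k i => [[]|] [[]|]. Qed.

Lemma other_colour_r k i : i != k -> other_colour k i != i.
Proof. by case: k i => [[]|] [[]|]. Qed.

Lemma other_colourP k i j : i != k -> j != k -> j = i \/ j = other_colour k i.
Proof. by case: k i j => [[]|] [[]|] [[]|] //; auto. Qed.

Lemma other_colourK k i : i != k -> other_colour k (other_colour k i) = i.
Proof. by case: k i => [[]|] [[]|]. Qed.

Lemma succ_colour_l k k' i : k != i -> k' != i -> k != k' ->
  (succ_colour k == i) != (succ_colour k' == i).
Proof. by case: k k' i => [[]|] [[]|] [[]|]. Qed.

Lemma succ_colour_r k i i' : i != k -> i' != k -> i != i' ->
  (succ_colour k == i) != (succ_colour k == i').
Proof. by case: k i i' => [[]|] [[]|] [[]|]. Qed.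

Section Colourings.

Variable G : sgraph.
Implicit Types (S : {set G}) (x y z u v w : G) (i j k : colour).

Notation colouring := {ffun G -> colour}.
Implicit Types c d : colouring.

Section Pinned.

Variables a b : G.

(** Colourings take the value [Some false] outside [S], so that the colourings of
    a subtree are a subset of one fixed type.  Two proper colourings in which the
    adjacent vertices [a] and [b] have prescribed colours induce the same partition
    only if they are equal. *)
Definition pinned S : {set colouring} :=
  [set c : colouring | [&& c a == Some false, c b == Some true,
     [forall v, (v \notin S) ==> (c v == Some false)] &
     [forall u in S, forall v in S, adj u v ==> (c u != c v)]]].

Definition recolour c x i : colouring := [ffun v => if v == x then i else c v].

Definition agree_off z c d := [forall v, (v != z) ==> (c v == d v)].

Definition flip : rel colouring := [rel c d | (c != d) && [exists z, agree_off z c d]].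

Lemma agree_offP z c d : reflect (forall v, v != z -> c v = d v) (agree_off z c d).
Proof.
apply: (iffP forallP) => [h v vz|h v]; first by have := h v; rewrite vz => /eqP.
by apply/implyP => /h ->.
Qed.

Lemma agree_off_sym z c d : agree_off z c d = agree_off z d c.
Proof. by apply: eq_forallb => v; rewrite eq_sym [d v == _]eq_sym. Qed.

Lemma flipI z c d : c != d -> agree_off z c d -> flip c d.
Proof. by move=> cd h; rewrite /flip /= cd; apply/existsP; exists z. Qed.

Lemma flip_sym : symmetric flip.
Proof.
move=> c d; rewrite /flip /= eq_sym; congr (_ && _).
by apply: eq_existsb => z; apply: agree_off_sym.
Qed.

Lemma pinnedP S c : reflect [/\ c a = Some false, c b = Some true,
    forall v, v \notin S -> c v = Some false &
    {in S &, forall u v, adj u v -> c u != c v}] (c \in pinned S).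
Proof.
rewrite inE; apply: (iffP and4P) => [[/eqP h1 /eqP h2 /forallP h3 /forall_inP h4]|[h1 h2 h3 h4]].
  split=> // [v vS|u v uS vS uv]; first by have := h3 v; rewrite vS => /eqP.
  by have /forall_inP/(_ v vS) := h4 u uS; rewrite uv.
split; [exact/eqP|exact/eqP| |].
  by apply/forallP => v; apply/implyP => /h3 ->.
by apply/forall_inP => u uS; apply/forall_inP => v vS; apply/implyP; apply: h4.
Qed.

Lemma flip_mem S c d z : c \in pinned S -> d \in pinned S -> c != d ->
  agree_off z c d -> [/\ z \in S, z != a, z != b & c z != d z].
Proof.
move=> /pinnedP[ca cb cS _] /pinnedP[da db dS _] cd /agree_offP h.
have zz : c z != d z.
  apply: contraNneq cd => e; apply/eqP/ffunP => v.
  by case: (eqVneq v z) => [->|/h].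
split=> //.
- by apply: contraNT zz => zS; rewrite cS ?dS.
- by apply: contraNneq zz => ->; rewrite ca da.
- by apply: contraNneq zz => ->; rewrite cb db.
Qed.

Lemma recolourE c x i v : recolour c x i v = if v == x then i else c v.
Proof. by rewrite ffunE. Qed.

Lemma recolour_id c x i : recolour c x i x = i.
Proof. by rewrite ffunE eqxx. Qed.

Lemma recolour_ne c x i v : v != x -> recolour c x i v = c v.
Proof. by rewrite ffunE => /negbTE->. Qed.

Section Leaf.

Variables (S : {set G}) (x y : G).
Hypotheses (aS : a \in S) (bS : b \in S) (xS : x \notin S) (yS : y \in S).
Hypothesis x_leaf : {in S, forall v, adj x v = (v == y)}.

Lemma neq_leaf v : v \in S -> v != x.
Proof. by move=> vS; apply: contraNneq xS => <-. Qed.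

Lemma pinned_recolour c i : c \in pinned S -> i != c y -> recolour c x i \in pinned (x |: S).
Proof.
move=> /pinnedP[ca cb cS cc] iy; apply/pinnedP; split.
- by rewrite recolour_ne ?neq_leaf.
- by rewrite recolour_ne ?neq_leaf.
- by move=> v; rewrite in_setU1 negb_or => /andP[vx vS]; rewrite recolour_ne ?cS.
- move=> u v; rewrite !in_setU1 => /orP[/eqP->|uS] /orP[/eqP->|vS].
  + by rewrite adj_irr.
  + by rewrite x_leaf // => /eqP->; rewrite recolour_id recolour_ne ?neq_leaf.
  + by rewrite adj_sym x_leaf // => /eqP->; rewrite recolour_id recolour_ne ?neq_leaf // eq_sym.
  + by rewrite !recolour_ne ?neq_leaf //; apply: cc.
Qed.

Lemma pinned_restrict c : c \in pinned (x |: S) ->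
  recolour c x (Some false) \in pinned S /\ c x != c y.
Proof.
move=> /pinnedP[ca cb cS cc]; split; last first.
  by apply: cc; rewrite ?setU11 // ?in_setU1 ?yS ?orbT // x_leaf.
apply/pinnedP; split.
- by rewrite recolour_ne ?neq_leaf.
- by rewrite recolour_ne ?neq_leaf.
- move=> v vS; rewrite recolourE; case: eqVneq => // vx; apply: cS.
  by rewrite in_setU1 negb_or vx.
- by move=> u v uS vS; rewrite !recolour_ne ?neq_leaf //; apply: cc; rewrite in_setU1 ?uS ?vS orbT.
Qed.

Lemma recolour_restrict c i : c \in pinned S -> recolour (recolour c x i) x (Some false) = c.
Proof.
move=> /pinnedP[_ _ cS _]; apply/ffunP => v; rewrite !recolourE.
by case: eqVneq => // ->; rewrite cS.
Qed.

Lemma recolourK c i : recolour (recolour c x i) x (c x) = c.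
Proof. by apply/ffunP => v; rewrite !recolourE; case: eqVneq => // ->. Qed.

End Leaf.

(** [flips v c] is the parity of the number of times that [v] has changed
    colour on the way to [c]. *)
Definition flip_parity S (flips : G -> colouring -> bool) : Prop :=
  forall c d z, c \in pinned S -> d \in pinned S -> c != d -> agree_off z c d ->
  {in S, forall v, (flips v c != flips v d) = (v == z)}.

Definition two_coloured S c0 : Prop :=
  [/\ a \in S, b \in S, c0 \in pinned S, forall v, c0 v != None &
    forall c, c \in pinned S -> (forall v, c v != None) -> c = c0].

Definition graded S c0 : Prop := two_coloured S c0 /\ exists flips, flip_parity S flips.

Lemma graded_edge : adj a b -> exists c0, graded [set a; b] c0 /\ pinned [set a; b] = [set c0].
Proof.
move=> ab; have ba : b != a by apply: contraTneq ab => ->; rewrite adj_irr.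
pose c0 : colouring := [ffun v => Some (v == b)].
have E c : c \in pinned [set a; b] -> c = c0.
  move=> /pinnedP[ca cb cS _]; apply/ffunP => v; rewrite ffunE.
  case: (eqVneq v b) => [->|vb]; first by rewrite cb.
  case: (eqVneq v a) => [->|va]; first by rewrite ca.
  by rewrite cS // !inE negb_or va vb.
have c0F : c0 \in pinned [set a; b].
  have nab : (a == b) = false by rewrite eq_sym (negbTE ba).
  apply/pinnedP; split.
  - by rewrite ffunE nab.
  - by rewrite ffunE eqxx.
  - by move=> v; rewrite !inE negb_or ffunE => /andP[_ /negbTE->].
  - by move=> u v; rewrite !inE !ffunE => /orP[]/eqP-> /orP[]/eqP->; rewrite ?adj_irr ?eqxx ?nab.
exists c0; split; last by apply/setP => c; apply/idP/set1P => [/E|->].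
split; first by split=> // [||v|c /E]; rewrite ?inE ?eqxx ?orbT ?ffunE.
exists (fun _ _ => false) => c d z /E-> /E->; by rewrite eqxx.
Qed.

(** The parity of a leaf [x] is that of its neighbour [y], corrected by the
    orientation of the edge [xy]: recolouring [x] reverses the edge, and recolouring
    [y] both reverses the edge and switches the parity of [y]. *)
Lemma graded_leaf S c0 x y : x \notin S -> y \in S ->
  {in S, forall v, adj x v = (v == y)} -> graded S c0 ->
  graded (x |: S) (recolour c0 x (other_colour (c0 y) None)).
Proof.
move=> xS yS xl [[aS bS c0F c0N c0U] [flips fl]].
have ny : None != c0 y by rewrite eq_sym.
have yx : y != x := neq_leaf xS yS.
split.
  split; rewrite ?in_setU1 ?aS ?bS ?orbT //.
  - by apply: (pinned_recolour aS bS xS yS xl) => //; apply: other_colour_l.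
  - by move=> v; rewrite recolourE; case: (v =P x) => // _; apply: other_colour_r.
  move=> c cF cN; have [rF cxy] := pinned_restrict aS bS xS yS xl cF.
  rewrite -(recolourK x c (Some false)); rewrite (c0U _ rF); last first.
    by move=> v; rewrite recolourE; case: (v =P x).
  have e : c0 y = c y by rewrite -(c0U _ rF) ?recolour_ne // => v; rewrite recolourE; case: (v =P x).
  congr (recolour c0 x _); rewrite e in ny *.
  have [cn|//] := other_colourP ny cxy.
  by have := cN x; rewrite cn.
pose r c := recolour c x (Some false).
have addbN (A B p q : bool) : (A (+) p != B (+) q) = (A != B) (+) (p != q).
  by case: A B p q => [] [] [] [].
exists (fun v c => if v == x then flips y (r c) (+) (succ_colour (c y) == c x) else flips v (r c)).
move=> c d z cF dF cd h v vS.
have [rcF cxy] := pinned_restrict aS bS xS yS xl cF.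
have [rdF dxy] := pinned_restrict aS bS xS yS xl dF.
have /agree_offP hz := h.
have [zS za zb cdz] := flip_mem cF dF cd h.
case: (eqVneq z x) => [zx|zx].
  subst z; have e : r c = r d.
    by apply/ffunP => w; rewrite !recolourE; case: eqP => // /eqP/hz.
  rewrite e; case: (eqVneq v x) => [_|_]; last by rewrite eqxx.
  have ey : c y = d y by apply: hz.
  by rewrite -ey in dxy *; rewrite addbN eqxx (succ_colour_r cxy dxy cdz).
have rcd : r c != r d.
  by apply: contraNneq cdz => /ffunP/(_ z); rewrite !recolour_ne // => ->.
have hr : agree_off z (r c) (r d).
  by apply/agree_offP => w wz; rewrite !recolourE; case: eqP => // _; apply: hz.
have F := fl _ _ _ rcF rdF rcd hr.
case: (eqVneq v x) vS => [->|vx]; last first.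
  by rewrite in_setU1 (negbTE vx) /= => /F.
move=> _; rewrite [x == z]eq_sym (negbTE zx).
have ex : c x = d x by apply: hz; rewrite eq_sym.
have := F y yS; case: (eqVneq y z) => [yz|yz].
  subst z; rewrite -ex in dxy *.
  have cyx : c y != c x by rewrite eq_sym.
  have dyx : d y != c x by rewrite eq_sym.
  by rewrite addbN (succ_colour_l cyx dyx cdz) => ->.
by move=> /negbFE/eqP->; rewrite (hz y) // ex eqxx.
Qed.

(** A Gray code of the colourings that pin the edge [ab]: [c0] is the
    two-colouring, and [z] and [u] are the vertices recoloured next to it. *)
Definition gray_code S c0 z u : Prop := graded S c0 /\ exists c d,
  [/\ traversal flip (pinned S :\ c0) c d, agree_off z c0 c & agree_off u c0 d].

Lemma gray_code_rev S c0 z u : gray_code S c0 z u -> gray_code S c0 u z.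
Proof.
move=> [bal [c [d [tr hc hd]]]]; split=> //; exists d, c; split=> //.
by apply: traversal_rev tr; apply: flip_sym.
Qed.

(** A single recolouring of the two-colouring has to use the third colour. *)
Lemma third_colour S c0 c z : two_coloured S c0 -> c \in pinned S :\ c0 ->
  agree_off z c0 c -> c z = None.
Proof.
move=> [_ _ c0F c0N c0U] /setD1P[cc0 cF] /agree_offP h.
apply/eqP; apply: contraNT cc0 => cz; apply/eqP/c0U => // v.
by case: (eqVneq v z) => [->//|/h<-].
Qed.

Lemma gray_code_mem S c0 z u : gray_code S c0 z u ->
  [/\ z \in S, z != a & z != b].
Proof.
move=> [[[_ _ c0F _ _] _] [c [d [tr hc _]]]].
have [/setD1P[cc0 cF] _] := traversal_mem tr.
by have [] := flip_mem c0F cF (_ : c0 != c) hc; rewrite // eq_sym.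
Qed.

(** A leaf attached to [a] has the same two colours available throughout, so that
    the colourings form a prism: the cycle is followed with one colour of [x], then
    backwards with the other. *)
Lemma prism S c0 x : x \notin S -> {in S, forall v, adj x v = (v == a)} ->
  (graded S c0 /\ pinned S = [set c0] -> exists c0', gray_code (x |: S) c0' x x) /\
  (forall z u, gray_code S c0 z u -> exists c0', gray_code (x |: S) c0' z x).
Proof.
move=> xS xl.
pose f i c := recolour c x i.
have fr0 : graded S c0 -> pinned (x |: S) = f (Some true) @: pinned S :|: f None @: pinned S.
  move=> [[aS bS c0F _ _] _]; apply/setP => c; apply/idP/setUP => [cF|[]/imsetP[d dF ->]].
  - have [rF cx] := pinned_restrict aS bS xS aS xl cF.
    have /pinnedP[ca _ _ _] := cF.
    have : c x = Some true \/ c x = None by move: cx; rewrite ca; case: (c x) => [[]|]; auto.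
    by case=> cx'; [left|right]; apply/imsetP; exists (recolour c x (Some false)); rewrite // /f -cx' recolourK.
  - by apply: (pinned_recolour aS bS xS aS xl dF); have /pinnedP[-> _ _ _] := dF.
  - by apply: (pinned_recolour aS bS xS aS xl dF); have /pinnedP[-> _ _ _] := dF.
have nr : graded S c0 -> other_colour (c0 a) None = Some true.
  by move=> [[_ _ /pinnedP[-> _ _ _] _ _] _].
have fN c d i j : i != j -> f i c != f j d.
  by apply: contraNneq => /ffunP/(_ x); rewrite /f !recolour_id => ->.
split=> [[bal e1]|z u [bal [c [d [tr hc hd]]]]].
  exists (f (Some true) c0); have [[aS bS c0F _ _] _] := bal.
  split; first by rewrite /f -nr //; apply: graded_leaf bal.
  have -> : pinned (x |: S) :\ f (Some true) c0 = [set f None c0].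
    rewrite fr0 // e1 !imset_set1; apply/setP => c; rewrite !inE.
    by case: (eqVneq c (f None c0)) => [->|_]; [rewrite fN ?orbT|rewrite orbF andNb].
  exists (f None c0), (f None c0); split; first exact: traversal1.
    by apply/agree_offP => v vx; rewrite /f !recolour_ne.
  by apply/agree_offP => v vx; rewrite /f !recolour_ne.
exists (f (Some true) c0); have [[aS bS c0F _ _] _] := bal.
split; first by rewrite /f -nr //; apply: graded_leaf bal.
have finj i : {in pinned S &, injective (f i)}.
  move=> c' d' c'F d'F e.
  by rewrite -(recolour_restrict xS i c'F) -/(f i c') e (recolour_restrict xS i d'F).
have fmono i : {in pinned S :\ c0 &, forall c d, flip c d -> flip (f i c) (f i d)}.
  move=> c' d' /setD1P[_ c'F] /setD1P[_ d'F] /andP[n /existsP[w /agree_offP hw]].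
  apply: (flipI (z := w)); first by apply: contraNneq n => /finj->.
  by apply/agree_offP => v vw; rewrite !recolourE hw.
have finj' i : {in pinned S :\ c0 &, injective (f i)}.
  by move=> c' d' /setD1P[_ h] /setD1P[_ h']; apply: finj.
have [cF dF] := traversal_mem tr.
exists (f (Some true) c), (f None c0); split; last 2 first.
- by apply/agree_offP => v vz; rewrite !recolourE; move/agree_offP: hc => ->.
- by apply/agree_offP => v vx; rewrite !recolour_ne.
have -> : pinned (x |: S) :\ f (Some true) c0 =
    (f (Some true) @: (pinned S :\ c0) :|: f None @: (pinned S :\ c0)) :|: [set f None c0].
  rewrite fr0 //; apply/setP => e; apply/setD1P/setUP.
    move=> [n /setUP[]/imsetP[e' e'F eE]]; last first.
      case: (eqVneq e' c0) => [e0|e0]; first by right; rewrite eE e0 inE.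
      by left; apply/setUP; right; rewrite eE imset_f // in_setD1 e0.
    left; apply/setUP; left; rewrite eE imset_f // in_setD1 e'F andbT.
    by apply: contraNneq n => <-; rewrite eE.
  case=> [/setUP[]/imsetP[e' /setD1P[n e'F] ->]|/set1P->].
  - split; last by rewrite inE imset_f.
    by apply: contraNneq n => /finj->.
  - by split; [apply: fN|rewrite inE imset_f ?orbT].
  - by split; [apply: fN|rewrite inE [X in _ || X]imset_f ?orbT].
apply: traversal_cat (_ : traversal flip _ (f (Some true) c) (f None c)) _ (traversal1 _ _).
- rewrite disjoint_sym disjoints1 !inE negb_or; apply/andP; split.
    by apply/imsetP => -[e' _ /eqP]; rewrite (negbTE (fN _ _ _ _ _)).
  by apply/imsetP => -[e' /setD1P[n e'F] /finj e]; rewrite -e ?eqxx in n.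
- apply: traversal_cat (traversal_map (@finj' _) (@fmono _) tr) _
    (traversal_map (@finj' _) (@fmono _) (traversal_rev flip_sym tr)).
    rewrite disjoint_subset; apply/subsetP => _ /imsetP[e' _ ->]; rewrite !inE.
    by apply/imsetP => -[e'' _ /eqP]; rewrite (negbTE (fN _ _ _ _ _)).
  apply: (flipI (z := x)); first exact: fN.
  by apply/agree_offP => v vx; rewrite !recolour_ne.
- rewrite flip_sym; apply: (flipI (z := z)).
    by have /setD1P[n cF'] := cF; apply: contraNneq n => /finj->.
  by apply/agree_offP => v vz; rewrite !recolourE; move/agree_offP: hc => ->.
Qed.

End Pinned.

End Colourings.

(** * Two leaves with different neighbours *)

Section Square.

Variables (G : sgraph) (a b : G) (S : {set G}) (x x' y y' : G).
Notation colouring := {ffun G -> colour}.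
Implicit Types (z u v w : G) (i j k : colour) (c d e : colouring).

Hypotheses (aS : a \in S) (bS : b \in S) (xS : x \notin S) (x'S : x' \notin S).
Hypotheses (xx' : x != x') (yS : y \in S) (y'S : y' \in S) (yy' : y != y').
Hypothesis x_leaf : {in x' |: S, forall v, adj x v = (v == y)}.
Hypothesis x'_leaf : {in S, forall v, adj x' v = (v == y')}.

Let S2 : {set G} := x |: (x' |: S).

Definition corner c i j : colouring := recolour (recolour c x' j) x i.
Definition base c : colouring := recolour (recolour c x (Some false)) x' (Some false).
Definition lifts (s : seq colouring) : {set colouring} :=
  [set c in pinned a b S2 | base c \in s].

Lemma corner_x c i j : corner c i j x = i.
Proof. exact: recolour_id. Qed.

Lemma corner_x' c i j : corner c i j x' = j.
Proof. by rewrite /corner recolour_ne ?recolour_id // eq_sym. Qed.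

Lemma base_in c v : v \in S -> base c v = c v.
Proof. by move=> vS; rewrite /base !recolour_ne //; [apply: neq_leaf vS|apply: neq_leaf vS]. Qed.

Lemma cornerK c : corner (base c) (c x) (c x') = c.
Proof.
apply/ffunP => v; rewrite /corner /base !recolourE.
by case: eqVneq => [->//|vx]; case: eqVneq => [->|].
Qed.

Lemma xS2 : x \notin x' |: S. Proof. by rewrite in_setU1 negb_or xx'. Qed.
Lemma yS2 : y \in x' |: S. Proof. by rewrite in_setU1 yS orbT. Qed.
Lemma aS2 : a \in x' |: S. Proof. by rewrite in_setU1 aS orbT. Qed.
Lemma bS2 : b \in x' |: S. Proof. by rewrite in_setU1 bS orbT. Qed.

Lemma corner_pinned c i j : c \in pinned a b S -> i != c y -> j != c y' ->
  corner c i j \in pinned a b S2.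
Proof.
move=> cF iy jy'; apply: (pinned_recolour aS2 bS2 xS2 yS2 x_leaf).
  exact: (pinned_recolour aS bS x'S y'S x'_leaf).
by rewrite recolour_ne // (neq_leaf x'S).
Qed.

Lemma base_corner c i j : c \in pinned a b S -> base (corner c i j) = c.
Proof.
move=> /pinnedP[_ _ cS _]; apply/ffunP => v; rewrite /corner /base !recolourE.
case: (eqVneq v x') => [->|_]; first by rewrite cS.
by case: (eqVneq v x) => [->|//]; rewrite cS.
Qed.

Lemma pinned_base c : c \in pinned a b S2 ->
  [/\ base c \in pinned a b S, c x != c y & c x' != c y'].
Proof.
move=> cF; have [cF1 cxy] := pinned_restrict aS2 bS2 xS2 yS2 x_leaf cF.
have [cF2 cx'y'] := pinned_restrict aS bS x'S y'S x'_leaf cF1.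
split=> //; have x'x : x' != x by rewrite eq_sym.
by move: cx'y'; rewrite (recolour_ne _ _ x'x) recolour_ne // (neq_leaf xS).
Qed.

Lemma corner_lifts c i j s : c \in pinned a b S -> i != c y -> j != c y' ->
  (corner c i j \in lifts s) = (c \in s).
Proof. by move=> cF iy jy; rewrite inE corner_pinned //= base_corner. Qed.

Lemma lifts1 c d : c \in pinned a b S -> d \in lifts [:: c] ->
  exists i j, [/\ i != c y, j != c y' & d = corner c i j].
Proof.
move=> cF; rewrite inE mem_seq1 => /andP[/pinned_base[_ dy dy'] /eqP bd].
by exists (d x), (d x'); rewrite -bd !base_in // cornerK.
Qed.

Lemma lifts_cons c s : lifts (c :: s) = lifts [:: c] :|: lifts s.
Proof. by apply/setP => d; rewrite !inE -andb_orr. Qed.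

Lemma lifts_disjoint c s : c \notin s -> [disjoint lifts [:: c] & lifts s].
Proof.
move=> cs; rewrite disjoint_subset; apply/subsetP => d /setIdP[_].
by rewrite mem_seq1 => /eqP bd; rewrite !inE bd (negbTE cs) andbF.
Qed.

Lemma flip_x c i i' j : i != i' -> @flip G (corner c i j) (corner c i' j).
Proof.
move=> ii; apply: (flipI (z := x)); first by apply: contraNneq ii => /ffunP/(_ x); rewrite !corner_x => ->.
by apply/agree_offP => v vx; rewrite /corner !(recolour_ne _ _ vx).
Qed.

Lemma flip_x' c i j j' : j != j' -> @flip G (corner c i j) (corner c i j').
Proof.
move=> ii; apply: (flipI (z := x')); first by apply: contraNneq ii => /ffunP/(_ x'); rewrite !corner_x' => ->.
by apply/agree_offP => v vx; rewrite /corner !recolourE (negbTE vx).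
Qed.

Lemma agree_corner c d z i j : agree_off z c d -> agree_off z (corner c i j) (corner d i j).
Proof.
move=> /agree_offP h; apply/agree_offP => v vz; rewrite /corner !recolourE.
by case: eqP => //; case: eqP => // _ _; apply: h.
Qed.

Lemma flip_corner c d z i j : c \in pinned a b S -> d \in pinned a b S -> c != d ->
  agree_off z c d -> @flip G (corner c i j) (corner d i j).
Proof.
move=> cF dF cd h; apply: (flipI (z := z)); last exact: agree_corner.
by apply: contraNneq cd => e; rewrite -(base_corner i j cF) e base_corner.
Qed.

Lemma corner_neq c i j i' j' : (i != i') || (j != j') -> corner c i j != corner c i' j'.
Proof.
case/orP => n; apply: contraNneq n => /ffunP e.
  by have := e x; rewrite !corner_x => ->.
by have := e x'; rewrite !corner_x' => ->.
Qed.

(** The four extensions of a colouring form a square, which can be crossed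
    from any corner to either of its neighbours. *)
Lemma square_traversal c i j : c \in pinned a b S -> i != c y -> j != c y' ->
  [/\ traversal (@flip G) (lifts [:: c]) (corner c i j) (corner c (other_colour (c y) i) j),
      traversal (@flip G) (lifts [:: c]) (corner c i j) (corner c i (other_colour (c y') j)),
      traversal (@flip G) (lifts [:: c] :\ corner c i j)
        (corner c (other_colour (c y) i) j) (corner c i (other_colour (c y') j)) &
      #|lifts [:: c]| = 4].
Proof.
move=> cF iy jy'.
set i' := other_colour (c y) i; set j' := other_colour (c y') j.
have i'y : i' != c y := other_colour_l iy; have j'y : j' != c y' := other_colour_l jy'.
have ii' : i != i' by rewrite eq_sym other_colour_r.
have jj' : j != j' by rewrite eq_sym other_colour_r.
have i'i : i' != i by rewrite eq_sym.
have j'j : j' != j by rewrite eq_sym.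
have mem : lifts [:: c] =i [:: corner c i j; corner c i' j; corner c i j'; corner c i' j'].
  move=> d; apply/idP/idP => [/(lifts1 cF)[k [l [ky ly ->]]]|].
    by have [->|->] := other_colourP iy ky; have [->|->] := other_colourP jy' ly; rewrite !inE eqxx ?orbT.
  by rewrite !in_cons in_nil orbF => /or4P[]/eqP->; rewrite corner_lifts // mem_head.
have un : uniq [:: corner c i j; corner c i' j; corner c i j'; corner c i' j'].
  by rewrite /= !inE !negb_or !corner_neq ?ii' ?jj' ?i'i ?j'j ?orbT.
split.
- exists [:: corner c i j'; corner c i' j'; corner c i' j]; split=> //.
  + by rewrite /= !flip_x' ?flip_x ?flip_x'.
  + by move: un; rewrite /= !inE !negb_or !corner_neq ?ii' ?jj' ?i'i ?j'j ?orbT.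
  + by move=> d; rewrite mem !inE; do 4 case: (_ == _).
- exists [:: corner c i' j; corner c i' j'; corner c i j']; split=> //.
  + by rewrite /= !flip_x // flip_x'.
  + by move: un; rewrite /= !inE !negb_or !corner_neq ?ii' ?jj' ?i'i ?j'j ?orbT.
  + by move=> d; rewrite mem !inE; do 4 case: (_ == _).
- exists [:: corner c i' j'; corner c i j']; split=> //.
  + by rewrite /= flip_x' // flip_x.
  + by move: un; rewrite /= !inE !negb_or !corner_neq ?ii' ?jj' ?i'i ?j'j ?orbT.
  + move=> d; rewrite in_setD1 mem !inE; case: (eqVneq d (corner c i j)) => [->|_] /=.
      by rewrite !(negbTE (corner_neq _ _)) ?ii' ?jj' ?orbT.
    by do 3 case: (_ == _).
- by rewrite (eq_card mem); apply: (card_uniqP un).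
Qed.

Lemma lifts_even s : uniq s -> {subset s <= pinned a b S} -> ~~ odd #|lifts s|.
Proof.
elim: s => [_ _|c s IH /andP[cs us] sF].
  by rewrite (_ : lifts [::] = set0) ?cards0 //; apply/setP => d; rewrite !inE andbF.
have cF : c \in pinned a b S by apply: sF; rewrite inE eqxx.
rewrite lifts_cons cardsU (disjoint_setI0 (lifts_disjoint cs)) cards0 subn0.
have succ_ne k : succ_colour k != k by case: k => [[]|].
have [_ _ _ ->] := square_traversal cF (succ_ne (c y)) (succ_ne (c y')).
by rewrite oddD /= IH // => d ds; apply: sF; rewrite inE ds orbT.
Qed.

(** Whatever the corner at which a square is entered, one of its two exits
    leads on: a move at [y] blocks only the colour of [x], a move at [y'] only
    that of [x'], and the two exits differ in both. *)
Lemma lifts_traversal c s i j : path (@flip G) c s -> uniq (c :: s) ->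
  {subset c :: s <= pinned a b S} -> i != c y -> j != c y' ->
  exists i' j', [/\ i' != last c s y, j' != last c s y',
    traversal (@flip G) (lifts (c :: s)) (corner c i j)
      (corner (last c s) (other_colour (last c s y) i') j') &
    traversal (@flip G) (lifts (c :: s)) (corner c i j)
      (corner (last c s) i' (other_colour (last c s y') j'))].
Proof.
elim: s c i j => [|d s IH] c i j.
  move=> _ _ sF iy jy'; have cF : c \in pinned a b S by apply: sF; rewrite inE.
  by have [h1 h2 _ _] := square_traversal cF iy jy'; exists i, j.
move=> /andP[/andP[cd /existsP[z cz]] ps] /andP[cs us] sF iy jy'.
have cF : c \in pinned a b S by apply: sF; rewrite inE eqxx.
have dsF : {subset d :: s <= pinned a b S} by move=> e es; apply: sF; rewrite inE es orbT.
have dF : d \in pinned a b S by apply: dsF; rewrite inE eqxx.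
have [h1 h2 _ _] := square_traversal cF iy jy'.
have [f [g [fy gy' tr]]] : exists f g, [/\ f != d y, g != d y' &
    traversal (@flip G) (lifts [:: c]) (corner c i j) (corner c f g)].
  move/agree_offP: cz => cz.
  case: (eqVneq y z) => yz.
    have e : c y' = d y' by apply: cz; rewrite -yz eq_sym.
    case: (eqVneq i (d y)) => di.
      exists (other_colour (c y) i), j; split; rewrite -?e //.
      by rewrite -di other_colour_r.
    by exists i, (other_colour (c y') j); split; rewrite -?e ?other_colour_l.
  have e : c y = d y by apply: cz.
  case: (eqVneq j (d y')) => dj.
    exists i, (other_colour (c y') j); split; rewrite -?e //.
    by rewrite -dj other_colour_r.
  by exists (other_colour (c y) i), j; split; rewrite -?e ?other_colour_l.
have [i' [j' [i'y j'y t1 t2]]] := IH d f g ps us dsF fy gy'.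
exists i', j'; rewrite lifts_cons; split=> //.
  by apply: traversal_cat (lifts_disjoint cs) tr (flip_corner _ _ cF dF cd cz) t1.
by apply: traversal_cat (lifts_disjoint cs) tr (flip_corner _ _ cF dF cd cz) t2.
Qed.

Variable c0 : colouring.
Hypothesis bal : graded a b S c0.

Let q0 := corner c0 (other_colour (c0 y) None) (other_colour (c0 y') None).

Lemma seed_corner : [/\ c0 \in pinned a b S, other_colour (c0 y) None != c0 y,
  other_colour (c0 y') None != c0 y',
  other_colour (c0 y) None != None & other_colour (c0 y') None != None].
Proof.
have [[_ _ c0F c0N _] _] := bal.
by rewrite !other_colour_l ?other_colour_r // eq_sym.
Qed.

Lemma square_graded : graded a b S2 q0.
Proof.
have -> : q0 = recolour (recolour c0 x' (other_colour (c0 y') None)) x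
    (other_colour (recolour c0 x' (other_colour (c0 y') None) y) None).
  by rewrite /q0 /corner [in RHS]recolour_ne // (neq_leaf x'S).
by apply: graded_leaf xS2 yS2 x_leaf _; apply: graded_leaf bal.
Qed.

(** The final part of the cycle, after the squares above all other colourings. *)
Lemma square_last : [/\ traversal (@flip G) (lifts [:: c0] :\ q0)
    (corner c0 None (other_colour (c0 y') None)) (corner c0 (other_colour (c0 y) None) None),
  agree_off x q0 (corner c0 None (other_colour (c0 y') None)) &
  agree_off x' q0 (corner c0 (other_colour (c0 y) None) None)].
Proof.
have [[_ _ _ c0N _] _] := bal; have [c0F n1 n2 _ _] := seed_corner.
have [_ _ + _] := square_traversal c0F n1 n2; rewrite !other_colourK 1?eq_sym // => tr; split=> //.
  by apply/agree_offP => v vx; rewrite /q0 /corner !(recolour_ne _ _ vx).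
by apply/agree_offP => v vx; rewrite /q0 /corner !recolourE (negbTE vx).
Qed.

Lemma square_edge : pinned a b S = [set c0] -> gray_code a b S2 q0 x x'.
Proof.
move=> F1; have [tr h1 h2] := square_last; split; first exact: square_graded.
exists (corner c0 None (other_colour (c0 y') None)), (corner c0 (other_colour (c0 y) None) None); split=> //.
have -> // : pinned a b S2 = lifts [:: c0].
apply/setP => d; rewrite [RHS]inE mem_seq1; case: (boolP (d \in _)) => //= /pinned_base[dF _ _].
by move: dF; rewrite F1 inE => ->.
Qed.

(** Every step switches the parity of exactly one vertex, hence the sum. *)
Lemma flip_parity_last (flips : G -> colouring -> bool) c s :
  flip_parity a b S2 flips -> path (@flip G) c s -> {subset c :: s <= pinned a b S2} ->
  \big[addb/false]_(v in S2) flips v (last c s) =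
  \big[addb/false]_(v in S2) flips v c (+) odd (size s).
Proof.
move=> fl; elim: s c => [|d s IH] c; first by rewrite addbF.
move=> /andP[/andP[cd /existsP[z cz]] ps] sF.
have cF : c \in pinned a b S2 by apply: sF; rewrite inE eqxx.
have dF : d \in pinned a b S2 by apply: sF; rewrite !inE eqxx orbT.
rewrite /= IH //; last by move=> e es; apply: sF; rewrite inE es orbT.
have F := fl _ _ _ cF dF cd cz.
have [zS _ _ _] := flip_mem cF dF cd cz.
rewrite (bigD1 z) //= [in RHS](bigD1 z) //=.
rewrite (eq_bigr (fun v => flips v c)); last first.
  move=> v /andP[vS vz]; have := F v vS; rewrite (negbTE vz) => /negbFE/eqP->//.
have := F z zS; rewrite eqxx.
by case: (flips z c); case: (flips z d) => //= _; case: (\big[_/_]_(_ in _ | _) _); case: (odd _).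
Qed.

(** The tour starts at the corner of the last square next to [q0] and has odd
    length.  By [flip_parity_last] it cannot end at the corner of the first square
    next to [q0], so that both corners adjacent to that one are exits.  As [z] is
    not [y], the exit at which [x] has the third colour leads to the square of
    [q0], which is left for last. *)
Lemma square_step z u : gray_code a b S c0 z u -> z != y -> gray_code a b S2 q0 u x'.
Proof.
move=> [_ [c1 [cm [tr h1 hm]]]] zy.
have [two _] := bal; have [_ _ _ c0N _] := two; have [c0F n1 n2 n3 n4] := seed_corner.
have [tr3 hx hx'] := square_last.
have [c1F cmF] := traversal_mem tr.
have c1z := third_colour two c1F h1; have cmu := third_colour two cmF hm.
have [s [ps ls us ms]] := traversal_rev (@flip_sym G) tr.
have sF : {subset cm :: s <= pinned a b S} by move=> c; rewrite ms => /setD1P[].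
have c0s : c0 \notin cm :: s by rewrite ms !inE eqxx.
set n := other_colour (c0 y) None in n1 n3 tr3 hx hx' *.
set n' := other_colour (c0 y') None in n2 n4 tr3 hx hx' *.
have avoid c w v : agree_off w c0 c -> c w = None -> other_colour (c0 v) None != c v.
  move=> /agree_offP h cw; case: (eqVneq v w) => [->|vw]; first by rewrite cw other_colour_r // eq_sym.
  by rewrite -h // other_colour_l // eq_sym.
have ncm : n != cm y := avoid _ _ y hm cmu.
have n'cm : n' != cm y' := avoid _ _ y' hm cmu.
have nc1 : n != c1 y := avoid _ _ y h1 c1z.
have n'c1 : n' != c1 y' := avoid _ _ y' h1 c1z.
have c1y : c1 y = c0 y by move/agree_offP: h1 => ->; rewrite // eq_sym.
have {c1F} /setD1P[c10 c1F] := c1F; have {cmF} /setD1P[cm0 cmF] := cmF.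
have q0F : q0 \in pinned a b S2 by apply: corner_pinned.
have start : corner cm n n' \in pinned a b S2 by apply: corner_pinned.
have [_ [flips fl]] := square_graded.
pose par c := \big[addb/false]_(v in S2) flips v c.
have par_flip w c d : c \in pinned a b S -> d \in pinned a b S -> c != d -> agree_off w c d ->
    n != c y -> n' != c y' -> n != d y -> n' != d y' ->
    par (corner c n n') = ~~ par (corner d n n').
  move=> cF dF cd h cy cy' dy dy'.
  have pth : path (@flip G) (corner d n n') [:: corner c n n'].
    by rewrite /= flip_sym (flip_corner _ _ cF dF cd h).
  rewrite /par -addbT; apply: (flip_parity_last fl pth) => e.
  by rewrite !in_cons in_nil orbF => /orP[]/eqP->; apply: corner_pinned.
have par_trav c d : traversal (@flip G) (lifts (cm :: s)) c d -> par d = ~~ par c.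
  move=> [t [pt lt ut mt]]; have sub : {subset c :: t <= pinned a b S2}.
    by move=> e; rewrite mt => /setIdP[].
  rewrite -lt /par (flip_parity_last fl pt sub).
  have := lifts_even us sF; rewrite -(eq_card mt) (card_uniqP ut) /= negbK => ->.
  by rewrite addbT.
(* Both corners are at distance one from [q0], whereas the traversal has odd length. *)
have not_nn : ~ traversal (@flip G) (lifts (cm :: s)) (corner cm n n') (corner c1 n n').
  move/par_trav; rewrite (par_flip z c1 c0) // 1?agree_off_sym //.
  rewrite (par_flip u cm c0) // 1?agree_off_sym //.
  by case: (par _).
have [i' [j' []]] := lifts_traversal ps us sF ncm n'cm; rewrite ls => i'y j'y t1 t2.
have Ny : None != c1 y by rewrite c1y eq_sym.
have t3 : traversal (@flip G) (lifts (cm :: s)) (corner cm n n') (corner c1 None n').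
  have rn : other_colour (c1 y) n = None by rewrite c1y /n other_colourK // eq_sym.
  have rN : other_colour (c1 y) None = n by rewrite c1y.
  (* The exits are opposite corners, and [not_nn] excludes one pair of them. *)
  have [i'E|i'E] := other_colourP Ny i'y; last rewrite rN in i'E; subst i'.
    have [j'E|j'E] := other_colourP n'c1 j'y; subst j'; last by rewrite other_colourK // in t2.
    by rewrite rN in t1.
  have [j'E|j'E] := other_colourP n'c1 j'y; subst j'; first by rewrite rn in t1.
  by rewrite other_colourK // in t2.
split; first exact: square_graded.
exists (corner cm n n'), (corner c0 n None); split=> //; last exact: agree_corner.
have -> : pinned a b S2 :\ q0 = lifts (cm :: s) :|: (lifts [:: c0] :\ q0).
  apply/setP => d; rewrite in_setD1 in_setU in_setD1 [d \in lifts (_ :: _)]inE [d \in lifts [:: _]]inE.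
  case: (boolP (d \in pinned _ _ _)) => [/pinned_base[dF _ _]|_] /=; last by rewrite !andbF.
  rewrite andbT ms in_setD1 dF andbT mem_seq1.
  case: (eqVneq d q0) => [->|_] /=; last by rewrite orNb.
  by rewrite base_corner // eqxx.
apply: traversal_cat t3 _ tr3.
  apply: disjointWr (subD1set _ _) _; rewrite disjoint_sym; exact: lifts_disjoint.
by apply: (@flip_corner c1 c0 z) => //; rewrite agree_off_sym.
Qed.

End Square.

(** * Three cells *)

Section ColourClasses.

Variable G : sgraph.
Notation colouring := {ffun G -> colour}.
Implicit Types (S A B : {set G}) (P Q : {set {set G}}) (z u v w t x y : G) (c d : colouring).

Definition classes S c : {set {set G}} :=
  [set [set v in S | c v == k] | k : colour] :\ set0.

Lemma classesP S c A : reflect (exists2 v, v \in S & A = [set w in S | c w == c v])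
  (A \in classes S c).
Proof.
apply: (iffP setD1P) => [[A0 /imsetP[k _ AE]]|[v vS ->]].
  have /set0Pn[v] := A0; rewrite AE inE => /andP[vS /eqP vk].
  by exists v => //; rewrite vk.
split; last by apply/imsetP; exists (c v).
by apply/set0Pn; exists v; rewrite inE vS eqxx.
Qed.

Lemma classes_mem S c v : v \in S -> [set w in S | c w == c v] \in classes S c.
Proof. by move=> vS; apply/classesP; exists v. Qed.

Lemma classes_partition S c : partition (classes S c) S.
Proof.
apply: partitionI => [_ /classesP[v vS ->]|v vS|A B w].
- split; first by apply/set0Pn; exists v; rewrite inE vS eqxx.
  by apply/subsetP => w; rewrite inE => /andP[].
- by exists [set w in S | c w == c v]; [apply: classes_mem|rewrite inE vS eqxx].
- move=> /classesP[u uS ->] /classesP[v vS ->]; rewrite !inE.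
  by move=> /andP[_ /eqP<-] /andP[_ /eqP<-].
Qed.

Lemma eq_classes S c d : {in S, c =1 d} -> classes S c = classes S d.
Proof.
move=> e; apply/setP => A; have E v : v \in S -> [set w in S | c w == c v] = [set w in S | d w == d v].
  by move=> vS; apply/setP => w; rewrite !inE; case: (boolP (w \in S)) => //= wS; rewrite !e.
by apply/classesP/classesP => -[v vS ->]; exists v; rewrite ?E.
Qed.

Lemma rst_classes z S c : rst z (classes S c) = classes (S :\ z) c.
Proof.
have E v : [set w in S :\ z | c w == c v] = [set w in S | c w == c v] :\ z.
  by apply/setP => w; rewrite !inE andbA.
apply/setP => A; apply/rstP/classesP => [[B /classesP[v vS ->] [-> B0]]|[v /setD1P[vz vS] ->]].
  have /set0Pn[w] := B0; rewrite !inE => /and3P[wz wS /eqP e].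
  by exists w; rewrite ?inE ?wz // E e.
exists [set w in S | c w == c v]; first exact: classes_mem.
by rewrite E; split=> //; apply/set0Pn; exists v; rewrite !inE vz vS eqxx.
Qed.

Lemma classes_single S c u : u \in S -> {in S :\ u, forall v, c v != c u} ->
  classes S c = add_single u (classes (S :\ u) c).
Proof.
move=> uS cu; have E : [set w in S | c w == c u] = [set u].
  apply/setP => w; rewrite !inE; case: (eqVneq w u) => [->|wu]; first by rewrite uS eqxx.
  by apply/negP => /andP[wS]; apply/negP; apply: cu; rewrite !inE wu.
have E' v : v \in S -> v != u -> [set w in S :\ u | c w == c v] = [set w in S | c w == c v].
  move=> vS vu; apply/setP => w; rewrite !inE; case: (eqVneq w u) => [->|//].
  by rewrite uS eq_sym (negbTE (cu v _)) // !inE vu.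
apply/setP => A; apply/classesP/setU1P => [[v vS ->]|[->|/classesP[v /setD1P[vu vS] ->]]].
- case: (eqVneq v u) => [->|vu]; [by left|right].
  by apply/classesP; exists v; rewrite ?inE ?vu ?E'.
- by exists u; rewrite ?E.
- by exists v; rewrite ?E'.
Qed.

Lemma classes_inj S c : {in S &, injective c} -> classes S c = [set [set v] | v in S].
Proof.
move=> ci; have E v : v \in S -> [set w in S | c w == c v] = [set v].
  move=> vS; apply/setP => w; rewrite !inE.
  apply/andP/eqP => [[wS /eqP/ci]|->]; first by apply.
  by rewrite vS eqxx.
by apply/setP => A; apply/classesP/imsetP => -[v vS ->]; exists v; rewrite ?E.
Qed.

Lemma card_colour : #|{: colour}| = 3.
Proof. by rewrite card_option card_bool. Qed.

Lemma classes_card_le S c : #|classes S c| <= 3.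
Proof.
apply: leq_trans (subset_leq_card (subD1set _ _)) _.
by apply: leq_trans (leq_imset_card _ _) _; rewrite card_colour.
Qed.

Section Three.

Variables (a b : G) (S : {set G}) (c0 : colouring).
Hypothesis two : two_coloured a b S c0.

Lemma third_class c : c \in pinned a b S :\ c0 -> exists2 v, v \in S & c v = None.
Proof.
have [_ _ _ _ c0U] := two; move=> /setD1P[cc0 cF].
have /existsP[v /eqP cv] : [exists v, c v == None].
  apply: contraNT cc0 => /existsPn h; apply/eqP; apply: c0U => // v; exact: h.
exists v => //; have /pinnedP[_ _ cS _] := cF.
by apply/negPn/negP => /cS; rewrite cv.
Qed.

Lemma classes_stirling c : c \in pinned a b S :\ c0 -> classes S c \in stirling 3 S.
Proof.
move=> cF'; have [v vS cv] := third_class cF'.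
have [aS bS _ _ _] := two; have /setD1P[_ /pinnedP[ca cb cS cc]] := cF'.
apply/stirlingP; split; first exact: classes_partition.
- have ex k : exists2 w, w \in S & c w = k.
    by case: k => [[]|]; [exists b|exists a|exists v].
  rewrite /classes setD1_notin; last first.
    apply/imsetP => -[k _ e]; have [w wS wk] := ex k.
    by have := in_set0 w; rewrite e inE wS wk eqxx.
  rewrite card_in_imset ?card_colour // => k l _ _ e; have [w wS wk] := ex k.
  have : w \in [set v in S | c v == k] by rewrite inE wS wk eqxx.
  by rewrite e inE wk => /andP[_ /eqP].
- move=> _ /classesP[u uS ->]; apply/indepP => w w'; rewrite !inE.
  move=> /andP[wS /eqP wu] /andP[w'S /eqP w'u]; apply/negP => /(cc w w' wS w'S).
  by rewrite wu w'u eqxx.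
Qed.

Lemma classes_pinned_inj : {in pinned a b S &, injective (classes S)}.
Proof.
have [aS bS _ _ _] := two.
move=> c d /pinnedP[ca cb cS cc] /pinnedP[da db dS dd] e; apply/ffunP => v.
case: (boolP (v \in S)) => vS; last by rewrite cS ?dS.
have same u w : u \in S -> w \in S -> (c u == c w) = (d u == d w).
  move=> uS wS; have : [set x in S | c x == c w] \in classes S d by rewrite -e classes_mem.
  case/classesP => x xS E.
  have : (w \in [set x in S | c x == c w]) by rewrite inE wS eqxx.
  rewrite E inE => /andP[_ /eqP dw].
  have : (u \in [set x in S | c x == c w]) = (c u == c w) by rewrite inE uS.
  by move<-; rewrite E inE uS dw.
have := same v a vS aS; have := same v b vS bS; rewrite ca cb da db.
by case: (c v) => [[]|]; case: (d v) => [[]|].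
Qed.

(** The colours are read off from the cells: that of [a], that of [b], and the
    remaining one. *)
Lemma classes_onto P : adj a b -> P \in stirling 3 S ->
  exists2 c, c \in pinned a b S :\ c0 & P = classes S c.
Proof.
move=> ab /stirlingP[pP cP iP]; have [aS bS c0F c0N _] := two.
have [Ap aA] := cell_pblock pP aS; have [Bp bB] := cell_pblock pP bS.
have bA : b \notin pblock P a.
  apply/negP => bA; have /indepP/(_ a b aA bA) := iP _ Ap; by rewrite ab.
have AB : pblock P b != pblock P a by apply: contraNneq bA => <-.
pose c : colouring := [ffun v => if v \notin S then Some false
   else if v \in pblock P a then Some false else if v \in pblock P b then Some true else None].
have cE v : v \in S -> c v = if v \in pblock P a then Some false else
    if v \in pblock P b then Some true else None by rewrite ffunE => ->.
have excl v C D : C \in P -> D \in P -> v \in C -> C != D -> v \notin D.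
  by move=> CP DP vC; apply: contraNN => vD; rewrite (cell_eq pP CP DP vC vD).
have [D DE] : exists D, P :\ pblock P a :\ pblock P b = [set D].
  apply/cards1P; have := cP; rewrite (cardsD1 (pblock P a)) Ap.
  by rewrite (cardsD1 (pblock P b)) in_setD1 AB Bp !add1n => -[->].
have DP : [/\ D != pblock P a, D != pblock P b & D \in P].
  by have := set11 D; rewrite -DE !in_setD1 => /and3P[].
have [Da Db DP'] := DP.
have third v : v \in S -> c v = None -> v \in D.
  move=> vS; rewrite cE //; have [VP vV] := cell_pblock pP vS.
  case: ifP => // va; case: ifP => // vb _.
  have : pblock P v \in [set D].
    rewrite -DE !in_setD1 VP andbT; apply/andP; split.
      by apply: contraFneq vb => <-.
    by apply: contraFneq va => <-.
  by move/set1P => <-.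
have PE : P = classes S c.
  apply/eqP; rewrite eqEcard cP classes_card_le andbT; apply/subsetP => C CP.
  have /set0Pn[v vC] := cell_neq0 pP CP.
  have vS : v \in S by move: v vC; apply/subsetP; apply: cell_sub pP CP.
  apply/classesP; exists v => //; apply/setP => w; rewrite inE.
  case: (boolP (w \in S)) => wS /=; last first.
    by apply: contraNF wS => wC; move: w wC; apply/subsetP; apply: cell_sub pP CP.
  have iC C' : C' \in P -> v \in C' -> (w \in C) = (w \in C').
    by move=> C'P vC'; rewrite (cell_eq pP CP C'P vC vC').
  rewrite [c v]cE //; case: ifP => va.
    rewrite (iC _ Ap va) cE //; case: ifP => // _; by case: ifP.
  case: ifP => vb.
    rewrite (iC _ Bp vb) cE //; case: (boolP (w \in pblock P b)) => wb; last by case: ifP.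
    by rewrite (negbTE (excl _ _ _ Bp Ap wb AB)).
  have vD : v \in D by apply: third; rewrite // cE // va vb.
  rewrite (iC _ DP' vD); apply/idP/eqP => [wD|]; last exact: third.
  by rewrite cE // (negbTE (excl _ _ _ DP' Ap wD Da)) (negbTE (excl _ _ _ DP' Bp wD Db)).
exists c => //; rewrite in_setD1; apply/andP; split.
  have /set0Pn[v vD] := cell_neq0 pP DP'.
  have vS : v \in S by move: v vD; apply/subsetP; apply: cell_sub pP DP'.
  apply: contraTneq (c0N v) => <-; rewrite cE //.
  by rewrite (negbTE (excl _ _ _ DP' Ap vD Da)) (negbTE (excl _ _ _ DP' Bp vD Db)).
apply/pinnedP; split.
- by rewrite cE // aA.
- by rewrite cE // bB (negbTE bA).
- by move=> v vS; rewrite ffunE vS.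
- move=> u v uS vS uv; apply/negP => /eqP e.
  have C : [set w in S | c w == c v] \in P by rewrite PE classes_mem.
  have /indepP/(_ u v) := iP _ C; rewrite !inE uS vS e eqxx uv.
  by move=> /(_ isT isT).
Qed.

Lemma gray_traversal c d : adj a b -> traversal (@flip G) (pinned a b S :\ c0) c d ->
  traversal (@padj G) (stirling 3 S) (classes S c) (classes S d).
Proof.
move=> ab tr; have -> : stirling 3 S = classes S @: (pinned a b S :\ c0).
  apply/setP => P; apply/idP/imsetP => [/(classes_onto ab)[e eF ->]|[e eF ->]]; first by exists e.
  exact: classes_stirling.
have inj : {in pinned a b S :\ c0 &, injective (classes S)}.
  by move=> e f /setD1P[_ eF] /setD1P[_ fF]; apply: classes_pinned_inj.
apply: (traversal_map inj _ tr) => e f eF fF /andP[ef /existsP[z /agree_offP h]].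
apply: (padjI (x := z)); first by apply: contraNneq ef => /inj->.
by rewrite !rst_classes; apply: eq_classes => v /setD1P[vz _]; apply: h.
Qed.

End Three.

(** In the first partition of the path [z] is a singleton, in the last one [u] is.
    Splitting off [u] from the former, or [z] from the latter, gives the same
    partition into four cells. *)
Lemma gray_hooked a b S c0 z u t : adj a b -> gray_code a b S c0 z u ->
  z != u -> z != t -> u != t ->
  exists q q', traversal (@padj G) (stirling 3 S) q q' /\ hooked 3 S t q q'.
Proof.
move=> ab gr zu zt ut; have [zS za zb] := gray_code_mem gr.
have [uS ua ub] := gray_code_mem (gray_code_rev gr).
have [[two _] [c [d [tr hc hd]]]] := gr; have [aS bS c0F c0N _] := two.
have [cF dF] := traversal_mem tr.
have cz := third_colour two cF hc; have du := third_colour two dF hd.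
move/agree_offP: hc => hc; move/agree_offP: hd => hd.
exists (classes S c), (classes S d); split; first exact: gray_traversal two _ _ ab tr.
have cst := classes_stirling two cF.
have uc : [set u] \notin classes S c.
  have cu : c u != None by rewrite -hc ?c0N // eq_sym.
  apply/negP => /classesP[v vS /setP E].
  have := E u; rewrite !inE eqxx uS => /esym/eqP uv.
  have /setD1P[_ /pinnedP[ca cb _ _]] := cF.
  case e : (c u) cu => [[]|] // _.
    by have := E b; rewrite !inE eq_sym (negbTE ub) bS cb -uv e.
  by have := E a; rewrite !inE eq_sym (negbTE ua) aS ca -uv e.
have rst_u : classes (S :\ u) c \in stirling 3 (S :\ u) by rewrite -rst_classes rst_stirling.
have zSu : z \in S :\ u by rewrite !inE zu.
have uniq_z : {in S :\ u :\ z, forall v, c v != c z}.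
  by move=> v /setD1P[vz _]; rewrite cz -hc.
have zcl : [set z] \in classes (S :\ u) c by rewrite (classes_single zSu uniq_z) setU11.
have pst : add_single u (classes (S :\ u) c) \in stirling 4 S.
  by rewrite -{2}(setD1K uS); apply: add_single_stirling rst_u; rewrite !inE eqxx.
have nsng v A : v \notin A -> [set v] \notin classes A c.
  apply: contraNN => h; rewrite -sub1set; exact: cell_sub (classes_partition A c) h.
exists u, z, (add_single u (classes (S :\ u) c)); split=> //; first by rewrite eq_sym.
split; [exact: setU11|by rewrite inE zcl orbT| |].
- by rewrite rst_classes /add_single setU1K // nsng // !inE eqxx.
- have uz : u != z by rewrite eq_sym.
  have uSz : u \in S :\ z by rewrite !inE uz.
  rewrite rst_classes (classes_single uSz); last first.
    by move=> v /setD1P[vu _]; rewrite du -hd.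
  rewrite (classes_single zSu uniq_z) /add_single setUCA setU1K; last first.
    rewrite in_setU1 negb_or nsng ?andbT; last by rewrite !inE eqxx ?andbF.
    by apply: contraNneq zu => /set1_inj->.
  have -> : S :\ z :\ u = S :\ u :\ z by apply/setP => v; rewrite !inE andbCA.
  congr (_ |: _); apply: eq_classes => v.
  by move=> /setD1P[vz /setD1P[vu _]]; rewrite -hc // hd.
Qed.

(** Only leaves other than [b] are ever recoloured, so a given leaf can be spared by
    choosing it as [b]. *)
Lemma star_gray a b S : acyclic G -> a \in S -> b \in S -> b != a ->
  {in S :\ a, forall v, adj a v} ->
  (#|S| = 2 -> exists c0, graded a b S c0 /\ pinned a b S = [set c0]) /\
  (2 < #|S| -> exists c0 z u, gray_code a b S c0 z u /\ (3 < #|S| -> z != u)).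
Proof.
move=> acG; have [n] := ubnP #|S|; elim: n S => // n IH S.
rewrite ltnS => Sn aS bS ba st.
have cS : #|S| = #|S :\ a :\ b|.+2.
  by rewrite (cardsD1 a) aS (cardsD1 b) !inE ba bS.
case: (set_0Vmem (S :\ a :\ b)) => [S0|[x]].
  split; last by rewrite cS S0 cards0.
  have -> : S = [set a; b] by rewrite -(setD1K aS) -(setD1K (_ : b \in S :\ a)) ?S0 ?inE ?ba ?setU0.
  by move=> _; apply: graded_edge; apply: st; rewrite !inE ba.
rewrite !inE => /and3P[xb xa xS].
have SE : x |: (S :\ x) = S := setD1K xS.
have cx : #|S| = #|S :\ x|.+1 by rewrite (cardsD1 x) xS.
have x_leaf : {in S :\ x, forall v, adj x v = (v == a)}.
  move=> v /setD1P[vx vS]; apply/idP/eqP => [xv|->]; last by rewrite adj_sym st // !inE xa.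
  apply/eqP/negP => /negP va; case: (acG [:: a; x; v]); split=> //.
  have ax : adj a x by apply: st; rewrite !inE xa.
  have va' : adj v a by rewrite adj_sym st // !inE va.
  by rewrite /ucycle /= ax xv va' !inE negb_or ![a == _]eq_sym xa va eq_sym vx.
have Sn' : #|S :\ x| < n by rewrite -cx.
have aS' : a \in S :\ x by rewrite !inE eq_sym xa.
have bS' : b \in S :\ x by rewrite !inE eq_sym xb.
have [|h2 h3] := IH (S :\ x) Sn' aS' bS' ba.
  by move=> v /setD1P[va /setD1P[vx vS]]; apply: st; rewrite !inE va.
have xSx : x \notin S :\ x by rewrite !inE eqxx.
split=> [S2|].
  have : #|S :\ a :\ b| = 0 by move: S2; rewrite cS => -[].
  by move/eqP; rewrite cards_eq0 => /eqP/setP/(_ x); rewrite !inE xb xa xS.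
rewrite {1}cx ltnS leq_eqVlt => /orP[/eqP S2|S3].
  have [c0 [bal F1]] := h2 (esym S2).
  have [/(_ (conj bal F1))[c0' gr] _] := prism b c0 xSx x_leaf.
  by exists c0', x, x; rewrite SE in gr; split=> //; rewrite cx -S2.
have [c0 [z [u [gr _]]]] := h3 S3.
have [_ /(_ z u gr)[c0' gr']] := prism b c0 xSx x_leaf.
exists c0', z, x; rewrite SE in gr'; split=> // _.
by have [/setD1P[]] := gray_code_mem gr.
Qed.

Definition leaf_pair S S' x y x' y' : Prop :=
  [/\ [/\ x \notin S', x' \notin S', x != x' & x |: (x' |: S') = S],
      [/\ y \in S', y' \in S' & y != y'],
      {in x' |: S', forall v, adj x v = (v == y)},
      {in S', forall v, adj x' v = (v == y')} & connected_on S' /\ #|S| = #|S'|.+2].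

Lemma leaf_pair_sym S S' x y x' y' : leaf_pair S S' x y x' y' -> leaf_pair S S' x' y' x y.
Proof.
move=> [[xS x'S xx' SE] [yS y'S yy'] xl x'l ?]; split=> //.
- by rewrite setUCA eq_sym.
- by rewrite eq_sym.
- move=> v; rewrite in_setU1 => /orP[/eqP->|/x'l//].
  rewrite adj_sym xl ?setU11 // [x' == y](negbTE (_ : x' != y)); last by apply: contraNneq x'S => ->.
  by apply/esym/negbTE; apply: contraNneq xS => ->.
- by move=> v vS; apply: xl; rewrite inE vS orbT.
Qed.

(** Remove a leaf [x], with neighbour [y], and consider a longest path issued from
    [y]: either its end hangs at another vertex, or [y] is the centre of a star. *)
Lemma star_or_leaf_pair S : acyclic G -> connected_on S -> 2 < #|S| ->
  (exists2 a, a \in S & {in S :\ a, forall v, adj a v}) \/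
  exists S' x y x' y', leaf_pair S S' x y x' y'.
Proof.
move=> acG cS S2; have /set0Pn[t tS] : S != set0 by case: cS.
have [x [y [lf _ _]]] := leaf_exists acG cS tS (ltnW S2).
have [xS1 yS1 xl SE cE] := leafD1 lf.
have S1 : 1 < #|S :\ x| by rewrite -ltnS -cE.
have [x' [y' [lf' x'y star]]] := leaf_exists acG (leaf_connected_on cS lf) yS1 S1.
have [x'S' y'S' x'l SE' cE'] := leafD1 lf'.
have [xS yS yx _] := lf; have [x'S1 y'S1 y'x' _] := lf'.
case: (eqVneq y y') => yy'; [left|right].
  exists y => // v /setD1P[vy vS]; case: (eqVneq v x) => [->|vx].
    by rewrite adj_sym xl ?eqxx.
  by apply: star => //; rewrite !inE vy vx.
exists (S :\ x :\ x'), x, y, x', y'; split.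
- by split; rewrite ?SE' // ?inE ?eqxx ?andbF //; move: x'S1; rewrite !inE eq_sym => /andP[].
- by split=> //; rewrite in_setD1 eq_sym x'y.
- by rewrite SE'.
- by [].
- by split; [apply: leaf_connected_on lf'; apply: leaf_connected_on lf|rewrite cE cE'].
Qed.

Lemma gray_pair S S' x y x' y' a b c0 z u : a \in S' -> b \in S' ->
  leaf_pair S S' x y x' y' -> gray_code a b S' c0 z u -> z != y ->
  exists c0', gray_code a b S c0' u x'.
Proof.
move=> aS bS [[xS x'S xx' <-] [yS y'S yy'] xl x'l _] gr zy.
eexists; exact: (square_step aS bS xS x'S xx' yS y'S yy' xl x'l (proj1 gr) gr zy).
Qed.

Lemma edge_pair S S' x y x' y' : acyclic G -> leaf_pair S S' x y x' y' -> #|S'| = 2 ->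
  [/\ S' = [set y; y'], adj y y' & exists c0, gray_code y y' S c0 x x'].
Proof.
move=> acG [[xS x'S xx' SE] [yS y'S yy'] xl x'l [[_ cS] _]] S2.
have S'E : S' = [set y; y'].
  by apply/esym/eqP; rewrite eqEcard subUset !sub1set yS y'S S2 cards2 yy'.
have ad : adj y y'.
  have [|||u [v [/set1P-> vS]]] := cS [set y]; rewrite ?sub1set //.
  - by apply/set0Pn; exists y; rewrite inE.
  - by apply/eqP => e; have := S2; rewrite -e cards1.
  by move: vS; rewrite S'E !inE => /orP[/eqP->|/eqP->]; rewrite ?eqxx.
split=> //; have [c0] := graded_edge ad; rewrite -S'E -SE => -[bal F1].
by eexists; apply: (square_edge yS y'S xS x'S xx' yS y'S xl x'l bal F1).
Qed.

(** Reversing the cycle exchanges [z] and [u], and these differ on more than three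
    vertices.  A star on three vertices leaves a choice of the pinned edge. *)
Lemma gray_exists S f : acyclic G -> connected_on S -> 2 < #|S| ->
  exists a b c0 z u, [/\ adj a b, a \in S, b \in S, gray_code a b S c0 z u &
    z != f /\ (3 < #|S| -> z != u)].
Proof.
move=> acG; have [n] := ubnP #|S|; elim: n S f => // n IH S f.
rewrite ltnS => Sn cS S2; case: (star_or_leaf_pair acG cS S2) => [[a aS st]|].
  have [b [bS ba fb]] : exists b, [/\ b \in S, b != a & f \in S -> f != a -> f = b].
    case: (boolP ((f \in S) && (f != a))) => [/andP[fS fa]|h]; first by exists f.
    have : 0 < #|S :\ a| by move: S2; rewrite (cardsD1 a) aS; case: #|_|.
    case/card_gt0P => b /setD1P[ba bS]; exists b; split=> // fS fa.
    by rewrite fS fa in h.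
  have [_ /(_ S2)[c0 [z [u [gr zu]]]]] := star_gray acG aS bS ba st.
  exists a, b, c0, z, u; split=> //; first by apply: st; rewrite !inE ba.
  split=> //; have [zS za zb] := gray_code_mem gr.
  by apply: contraNneq zb => zf; apply/eqP; rewrite zf; apply: fb; rewrite -zf.
move=> [S' [x [y [x' [y' lp]]]]].
have [[xS x'S xx' SE] [yS y'S yy'] xl x'l [cS' cE]] := lp.
suff [a [b [c0 [z [u [ab aS bS gr zu]]]]]] : exists a b c0 z u, [/\ adj a b, a \in S', b \in S',
    gray_code a b S c0 z u & z != u].
  have sub : {subset S' <= S} by move=> v vS; rewrite -SE !inE vS !orbT.
  case: (eqVneq z f) => zf.
    exists a, b, c0, u, z; split=> //; [exact: sub|exact: sub|exact: gray_code_rev|].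
    by rewrite -zf eq_sym.
  by exists a, b, c0, z, u; split=> //; apply: sub.
have S'2 : 1 < #|S'|.
  by apply/card_gt1P; exists y, y'.
move: S'2; rewrite leq_eqVlt => /orP[/eqP S'2|S'2].
  have [_ ad [c0 gr]] := edge_pair acG lp (esym S'2).
  by exists y, y', c0, x, x'.
have [|a [b [c0 [z [u [ab aS bS gr [zy _]]]]]]] := IH S' y _ cS' S'2.
  by rewrite -ltnS (leq_trans _ (leqW Sn)) // cE.
have [c0' gr'] := gray_pair aS bS lp gr zy.
exists a, b, c0', u, x'; split=> //.
have [uS _ _] := gray_code_mem (gray_code_rev gr).
by apply: contraNneq x'S => <-.
Qed.

(** On four vertices the hook can only be the partition into singletons, and either
    element of the two-element cell can serve as the relocated vertex. *)
Lemma hooked_singles S c d t u w : #|S| = 4 -> u != w -> u != t -> w != t ->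
  u \in S -> w \in S -> {in S :\ u &, injective c} -> {in S :\ w &, injective d} ->
  hooked 3 S t (classes S c) (classes S d).
Proof.
move=> S4 uw ut wt uS wS ci di; exists u, w, [set [set v] | v in S]; split=> //.
  by rewrite (singles_stirling S4) inE.
have singlesD1 v : [set [set z] | z in S :\ v] = [set [set z] | z in S] :\ [set v].
  apply/setP => A; apply/imsetP/setD1P => [[z /setD1P[zv zS] ->]|[Av /imsetP[z zS AE]]].
    by split; [apply: contraNneq zv => /set1_inj->|apply/imsetP; exists z].
  by exists z => //; rewrite !inE zS andbT; apply: contraNneq Av => <-; rewrite AE.
by split; rewrite ?rst_classes ?classes_inj ?singlesD1 //; apply/imsetP; [exists u|exists w].
Qed.

(** On the path [x y y' x'] the vertices recoloured next to the two-colouring are the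
    two ends.  To avoid [x], the vertices [x'] and [y'] are relocated instead. *)
Lemma hooked_P4 S S' x y x' y' t : acyclic G -> leaf_pair S S' x y x' y' -> #|S'| = 2 ->
  exists q q', traversal (@padj G) (stirling 3 S) q q' /\ hooked 3 S t q q'.
Proof.
move=> acG; wlog tx' : x y x' y' / t != x'.
  move=> W; case: (eqVneq t x') => [tx'|]; last by apply: W.
  move=> lp S2; apply: W (leaf_pair_sym lp) S2.
  by have [[_ _ xx' _] _ _ _ _] := lp; rewrite tx' eq_sym.
move=> lp S2; have [S'E ad [c0 gr]] := edge_pair acG lp S2.
have [[xS x'S xx' SE] [yS y'S yy'] xl x'l [_ cE]] := lp.
case: (eqVneq t x) => [tx|tx]; last by apply: gray_hooked ad gr xx' _ _; rewrite eq_sym.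
have [[two _] [c [d [tr hc hd]]]] := gr; have [cF dF] := traversal_mem tr.
have cx := third_colour two cF hc; have dx' := third_colour two dF hd.
exists (classes S c), (classes S d); split; first exact: gray_traversal two _ _ ad tr.
have [_ _ /pinnedP[cy cy' _ cc] c0N _] := two.
move/agree_offP: hc => hc; move/agree_offP: hd => hd.
have x'x : x' != x by rewrite eq_sym.
have ne v w : v \in S' -> w \notin S' -> v != w by move=> vS; apply: contraNneq => <-.
have [Sx Sx' Sy Sy'] : [/\ x \in S, x' \in S, y \in S & y' \in S].
  by rewrite -SE !inE yS y'S !eqxx !orbT.
have c0x : c0 x = Some true.
  have := cc x y Sx Sy; rewrite xl ?in_setU1 ?yS ?orbT // eqxx cy => /(_ isT).
  by have := c0N x; case: (c0 x) => [[]|].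
have cE' v : v \in S :\ x' -> [\/ v = x, v = y | v = y'].
  rewrite -SE S'E !inE => /andP[/negbTE->] /= /or3P[]/eqP->; by [constructor 1|constructor 2|constructor 3].
have dE' v : v \in S :\ y' -> [\/ v = x, v = x' | v = y].
  rewrite -SE S'E !inE => /andP[/negbTE->] /=; rewrite orbF.
  by move=> /or3P[]/eqP->; [constructor 1|constructor 2|constructor 3].
apply: (hooked_singles (u := x') (w := y')) => //.
- by rewrite cE S2.
- by rewrite eq_sym ne.
- by rewrite eq_sym.
- by rewrite tx ne.
- have e1 : c y = Some false by rewrite -hc ?ne.
  have e2 : c y' = Some true by rewrite -hc ?ne.
  by move=> v w /cE'[]-> /cE'[]->; rewrite ?cx ?e1 ?e2.
- have e1 : d y = Some false by rewrite -hd ?ne.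
  have e2 : d x = Some true by rewrite -hd.
  by move=> v w /dE'[]-> /dE'[]->; rewrite ?dx' ?e1 ?e2.
Qed.

(** The two leaves removed and the direction of the cycle are chosen so that the
    vertices recoloured next to the two-colouring both differ from [t]. *)
Lemma hooked_three S t : acyclic G -> connected_on S -> 3 < #|S| ->
  exists q q', traversal (@padj G) (stirling 3 S) q q' /\ hooked 3 S t q q'.
Proof.
move=> acG cS S3; case: (star_or_leaf_pair acG cS (ltnW S3)) => [[a aS st]|].
  have [b [bS ba tb]] : exists b, [/\ b \in S, b != a & t \in S -> t != a -> t = b].
    case: (boolP ((t \in S) && (t != a))) => [/andP[tS ta]|h]; first by exists t.
    have : 0 < #|S :\ a| by move: S3; rewrite (cardsD1 a) aS; case: #|_|.
    case/card_gt0P => b /setD1P[ba bS]; exists b; split=> // tS ta.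
    by rewrite tS ta in h.
  have [_ /(_ (ltnW S3))[c0 [z [u [gr zu]]]]] := star_gray acG aS bS ba st.
  have [zS za zb] := gray_code_mem gr.
  have [uS ua ub] := gray_code_mem (gray_code_rev gr).
  apply: gray_hooked gr _ _ _; first by apply: st; rewrite !inE ba.
  - exact: zu.
  - by apply: contraNneq zb => zf; apply/eqP; rewrite zf; apply: tb; rewrite -zf.
  - by apply: contraNneq ub => uf; apply/eqP; rewrite uf; apply: tb; rewrite -uf.
move=> [S' [x [y [x' [y' lp]]]]].
have [[xS x'S xx' SE] [yS y'S yy'] xl x'l [cS' cE]] := lp.
have S'2 : 1 < #|S'| by apply/card_gt1P; exists y, y'.
move: S'2; rewrite leq_eqVlt => /orP[/eqP S'2|S'2].
  exact: hooked_P4 acG lp (esym S'2).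
have out v w : v \in S' -> w \notin S' -> v != w.
  by move=> vS; apply: contraNneq => <-.
case: (eqVneq t x) => [->|tx].
  have [a [b [c0 [z [u [ab aS bS gr [zy _]]]]]]] := gray_exists y acG cS' S'2.
  have [c0' gr'] := gray_pair aS bS lp gr zy.
  have [uS _ _] := gray_code_mem (gray_code_rev gr).
  by apply: gray_hooked ab gr' _ _ _; rewrite ?(out u) // 1?eq_sym.
case: (eqVneq t x') => [->|tx'].
  have [a [b [c0 [z [u [ab aS bS gr [zy _]]]]]]] := gray_exists y' acG cS' S'2.
  have [c0' gr'] := gray_pair aS bS (leaf_pair_sym lp) gr zy.
  have [uS _ _] := gray_code_mem (gray_code_rev gr).
  by apply: gray_hooked ab gr' _ _ _; rewrite ?(out u).
have [a [b [c0 [z [u [ab aS bS gr [zt _]]]]]]] := gray_exists t acG cS' S'2.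
have [zS _ _] := gray_code_mem gr.
case: (eqVneq u y) => uy.
  have uy' : u != y' by rewrite uy.
  have [c0' gr'] := gray_pair aS bS (leaf_pair_sym lp) (gray_code_rev gr) uy'.
  by apply: gray_hooked ab gr' (out z x zS xS) zt _; rewrite eq_sym.
have [c0' gr'] := gray_pair aS bS lp (gray_code_rev gr) uy.
by apply: gray_hooked ab gr' (out z x' zS x'S) zt _; rewrite eq_sym.
Qed.

End ColourClasses.

(** * Hamiltonicity for at least four cells *)

Theorem theorem4p10 (r : nat) (T : sgraph) :
  4 <= r -> tree T -> r.+1 <= #|T| -> hamiltonian (stirling_graph r T).
Proof.
move=> r4 [cT aT] rT; have cS := connected_onT cT.
have /set0Pn[t tT] : [set: T] != set0 by case: cS.
have rS : r < #|[set: T]| by rewrite cardsT.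
have [_ /(_ r4)[s [cyc us ms ss]]] :=
  stirling_cyclic aT (fun S t c h _ => hooked_three t aT c h) (ltnW r4) cS rS tT.
pose c : seq (stirling_graph r T) := pmap insub s.
have cE : map val c = s.
  rewrite pmap_filter; last exact: insubK.
  by apply/all_filterP/allP => p; rewrite ms inE /= isSome_insub.
exists c; split; last first.
  by move=> p; rewrite -(mem_map val_inj) cE ms inE; apply: (valP p).
split; first by rewrite -(size_map val) cE.
apply/andP; split; last by rewrite -(map_inj_uniq val_inj) cE.
by move: cyc; rewrite -cE cycle_map.
Qed.
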